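(* Let $P$ be a sequence of (finite) forest posets. If $|P|\to\infty$ and $\limsup \mathrm{rank}(P)/|P|<1$, then the corresponding sequence of standardized random variables $\mathcal X_P^*$ is asymptotically normal, i.e. converges in distribution to $\mathcal N(0,1)$.
   Context: A finite poset $P$ is a forest if every element is covered by at most one element (its Hasse diagram is a forest with roots as maximal elements). The hook length of $x\in P$ is $h_x=\#\{t\in P:t\le_P x\}$. $\mathrm{rank}(P)$ is the maximum number of elements in a chain of $P$. With $n=|P|$ and $[k]_q=1+q+\dots+q^{k-1}$, $[n]_q!=\prod_{k=1}^n[k]_q$, the polynomial $\mathcal L_P(q)=[n]_q!/\prod_{u\in P}[h_u]_q=\sum_k c_kq^k$ has nonnegative integer coefficients, and $\mathcal X_P$ is the random variable with $\mathbb P(\mathcal X_P=k)=c_k/\mathcal L_P(1)$ (equivalently, up to a shift, the major index or inversion number of a uniformly random linear extension under a suitable labeling). $\mathcal X^*=(\mathcal X-\mu)/\sigma$ denotes standardization. *)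

(* Defs.v *)
From HB Require Import structures.
From mathcomp Require Import all_boot all_order all_algebra.
From mathcomp Require Import all_classical all_reals all_analysis measurable_realfun.

Set Implicit Arguments.
Unset Strict Implicit.
Unset Printing Implicit Defensive.

Import Order.TTheory GRing.Theory Num.Theory.
Import numFieldNormedType.Exports.

Local Open Scope classical_set_scope.
Local Open Scope ring_scope.

Section ForestPosets.
Context (d : Order.disp_t) (T : finPOrderType d).

Definition covers (x y : T) : Prop :=
  (x < y)%O /\ forall z : T, ~ ((x < z)%O /\ (z < y)%O).

Definition is_forest : Prop :=
  forall x y z : T, covers x y -> covers x z -> y = z.

Definition hook_length (x : T) : nat := #|[pred t : T | (t <= x)%O]|.

Definition is_chain (C : {set T}) : bool :=
  [forall x in C, forall y in C, (x >=< y)%O].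

Definition poset_rank : nat := (\max_(C : {set T} | is_chain C) #|C|)%N.

End ForestPosets.

Arguments is_forest {d} T.
Arguments poset_rank {d} T.

Definition qint (F : fieldType) (k : nat) : {poly F} := \sum_(i < k) 'X^i.

Definition qfact (F : fieldType) (n : nat) : {poly F} :=
  \prod_(1 <= k < n.+1) qint F k.

(* [%/] is Euclidean division in F[q]; for a forest the denominator divides
   the numerator, so this is the exact quotient. *)
Definition forest_poly (F : fieldType) (d : Order.disp_t)
    (T : finPOrderType d) : {poly F} :=
  qfact F #|T| %/ \prod_(u : T) qint F (hook_length u).

Section Standardization.
Context (d : measure_display) (T : measurableType d) (R : realType).
Context (P : probability T R).

(* When the variance is 0 this is the zero random variable, as x / 0 = 0. *)
Definition standardize (X : {RV P >-> R}) : T -> R :=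
  fun w => (X w - fine 'E_P[X]) / Num.sqrt (fine 'V_P[X]).

Lemma measurable_standardize (X : {RV P >-> R}) :
  measurable_fun [set: T] (standardize X).
Proof. by apply: measurable_funM => //; apply: measurable_funB. Qed.

HB.instance Definition _ (X : {RV P >-> R}) :=
  isMeasurableFun.Build _ _ _ _ (standardize X) (measurable_standardize X).

End Standardization.

(* The variables may live on different probability spaces. *)
Definition cvg_in_distribution (R : realType) (d : measure_display)
    (T : nat -> measurableType d) (P : forall n, probability (T n) R)
    (X : forall n, {RV (P n) >-> R})
    (mu : probability (measurableTypeR R) R) : Prop :=
  forall x : R, {for x, continuous (fun r : R => mu `]-oo, r]%classic)} ->
    cdf (X n) x @[n --> \oo] --> mu `]-oo, x]%classic.

Arguments cvg_in_distribution {R d T} P X mu.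

Definition asymptotically_normal (R : realType) (d : measure_display)
    (T : nat -> measurableType d) (P : forall n, probability (T n) R)
    (X : forall n, {RV (P n) >-> R}) : Prop :=
  cvg_in_distribution P X (normal_prob 0 1).

Arguments asymptotically_normal {R d T} P X.

(* Main.v *)
(** The generating polynomial of a forest is a quotient of products of
q-integers.  A q-integer [k] contributes a factor sinc (k t / 2) to the centred
characteristic function and (k^2 - 1) / 12 to the variance.  As
log sinc x = - x^2 / 6 + O(x^4), the characteristic function of the standardized
variable at a is exp (- a^2 / 2 + O(n^5 / sigma^4)), so everything rests on
sigma^2 being of order n^3.  Listing the elements along a linear extension bounds
the i-th hook length by i; the sum of the hook lengths is the sum of the depths,
which are also bounded by the rank, so a rank at most (1 - c) n forces a total gap
of order n^2, and Cauchy-Schwarz turns it into a gap of order n^3 between the sums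
of squares.

Convergence of the characteristic functions gives convergence in distribution
because a step function is squeezed, up to a small error growing linearly, between
trigonometric polynomials. *)

From HB Require Import structures.
Require Import Defs.
From mathcomp Require Import all_boot all_order all_algebra.
From mathcomp Require Import all_classical all_reals all_analysis.
From mathcomp Require Import measurable_realfun zify ring lra.

Set Implicit Arguments.
Unset Strict Implicit.
Unset Printing Implicit Defensive.

Import Order.TTheory GRing.Theory Num.Theory.
Import numFieldNormedType.Exports.

(** * Hook lengths in forests *)

(** The hook factors stand in a denominator, so the law is not presented as that of a sum of
    independent variables. Mean and variance are therefore obtained from algebraic additivity under
    products, and each [sinc] factor is bounded on both sides. The lower bound asks for arguments
    [k t / 2] at most 1, that is [n t <= 2]; this holds eventually, since [t = a / sigma] with sigma
    of order at least n^(3/2). The error n^5 / sigma^4 is then of order 1 / n.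

    Complex exponentials are replaced by [cos (a x - b)] with a free phase [b]. This family carries
    real and imaginary parts at once and is stable under what the proof does to it: a q-integer
    factor shifts [b], and multiplication by [sin (c x)] yields two members of the family again.
    Tightness takes the form of a bound on the first absolute moment, which follows from the unit
    variance and absorbs the linearly growing error of the squeeze. *)

Lemma enum_by_level (T : finType) (f : T -> nat) :
  (forall u, f u <= #|[set t | f t < f u]|.+1) ->
  exists2 g : 'I_#|T| -> T, bijective g & forall i, f (g i) <= i.+1.
Proof.
move=> hf; pose s := sort (relpre f leq) (enum T).
have sz : size s == #|T| by rewrite size_sort -cardE.
have us : uniq s by rewrite sort_uniq enum_uniq.
have ss : sorted (relpre f leq) s by apply: sort_sorted => x y; exact: leq_total.
exists (tnth (Tuple sz)).
  apply: inj_card_bij; last by rewrite card_ord.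
  move=> i j; have x0 : T by exact: (tnth (Tuple sz) i).
  rewrite !(tnth_nth x0) => /eqP.
  by rewrite nth_uniq ?(eqP sz)// => /eqP /val_inj.
(* Elements with a value strictly below that of [g i] all occur among the first [i] entries of the
   sorted list, so there are at most [i] of them. *)
move=> i; apply: leq_trans (hf _) _; rewrite ltnS.
have x0 : T by exact: (tnth (Tuple sz) i).
apply: (@leq_trans #|[set x in take i s]|); last first.
  by rewrite cardsE (leq_trans (card_size _))// size_take; case: ltnP.
apply/subset_leq_card/fintype.subsetP => t; rewrite !inE => ft.
have ts : t \in s by rewrite mem_sort mem_enum.
rewrite in_take// ltnNge; apply/negP => ij.
have ilt : (i < size s)%N by rewrite (eqP sz).
have jlt : (index t s < size s)%N by rewrite index_mem.
have trf : transitive (relpre f leq) by move=> a b c; exact: leq_trans.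
have rff : reflexive (relpre f leq) by move=> a; exact: leqnn.
have := sorted_leq_nth trf rff x0 ss i (index t s) ilt jlt ij.
rewrite nth_index//= => fle; move: ft.
by rewrite (tnth_nth x0)/= ltnNge fle.
Qed.

(** Cauchy-Schwarz against a constant vector: both sides are doubled, and
    [2 a_i a_j <= a_i ^ 2 + a_j ^ 2] is summed over all ordered pairs. *)
Lemma sqr_sum_le (n : nat) (a : 'I_n -> nat) :
  (\sum_i a i) ^ 2 <= n * \sum_i a i ^ 2.
Proof.
rewrite -(leq_pmul2l (m := 2))//.
have -> : 2 * (\sum_i a i) ^ 2 = \sum_i \sum_j 2 * (a i * a j).
  rewrite -mulnn big_distrlr big_distrr /=.
  by apply: eq_bigr => i _; rewrite big_distrr.
have -> : 2 * (n * \sum_i a i ^ 2) = \sum_i \sum_(j < n) (a i ^ 2 + a j ^ 2).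
  under [RHS]eq_bigr do rewrite big_split /= sum_nat_const card_ord.
  by rewrite big_split /= sum_nat_const card_ord -big_distrr /=; lia.
by apply: leq_sum => i _; apply: leq_sum => j _; exact: nat_Cauchy.
Qed.

Section Forest.
Context (d : Order.disp_t) (T : finPOrderType d).
Implicit Types x y z : T.

Definition depth x : nat := #|[pred t : T | (x <= t)%O]|.

Lemma hook_length_lt x y : (x < y)%O -> hook_length x < hook_length y.
Proof.
move=> xy; apply: proper_card; apply/properP; split.
  by apply/fintype.subsetP => t; rewrite !inE => /le_trans; apply; exact: ltW.
by exists y; rewrite !inE ?lexx// lt_geF.
Qed.

Lemma depth_lt x y : (x < y)%O -> depth y < depth x.
Proof.
move=> xy; apply: proper_card; apply/properP; split.
  by apply/fintype.subsetP => t; rewrite !inE => /(le_trans (ltW xy)).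
by exists x; rewrite !inE ?lexx// lt_geF.
Qed.

Lemma hook_length_enum :
  exists2 g : 'I_#|T| -> T, bijective g & forall i, hook_length (g i) <= i.+1.
Proof.
apply: enum_by_level => u.
rewrite {1}/hook_length [leqLHS](cardD1 u) inE lexx add1n ltnS.
apply/subset_leq_card/fintype.subsetP => t; rewrite !inE => /andP[tu ut].
by apply: hook_length_lt; rewrite lt_neqAle tu.
Qed.

Lemma depth_enum :
  exists2 g : 'I_#|T| -> T, bijective g & forall i, depth (g i) <= i.+1.
Proof.
apply: enum_by_level => u.
rewrite {1}/depth [leqLHS](cardD1 u) inE lexx add1n ltnS.
apply/subset_leq_card/fintype.subsetP => t; rewrite !inE => /andP[tu ut].
by apply: depth_lt; rewrite lt_neqAle eq_sym tu.
Qed.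

(** Both sides count the pairs [t <= x], grouped by the larger or by the smaller element. *)
Lemma sum_hook_length_depth : \sum_(x : T) hook_length x = \sum_(x : T) depth x.
Proof.
rewrite /hook_length /depth.
under eq_bigr do rewrite -sum1_card big_mkcond.
under [RHS]eq_bigr do rewrite -sum1_card big_mkcond.
by rewrite exchange_big.
Qed.

(** An element of minimal hook length among those above [x] and at most [y] has nothing strictly
    between [x] and itself. *)
Lemma exists_cover x y : (x < y)%O -> exists2 c, covers x c & (c <= y)%O.
Proof.
move=> xy; case: (@arg_minnP _ y (fun c => (x < c)%O && (c <= y)%O) (@hook_length d T)).
  by rewrite xy lexx.
move=> c /andP[xc cy] cmin; exists c => //; split=> // z [xz zc].
have := cmin z; rewrite xz (le_trans (ltW zc) cy) => /(_ isT).
by rewrite leqNgt hook_length_lt.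
Qed.

Hypothesis forestT : is_forest T.

(** Induction on [depth x]: the covers of [x] towards [y] and towards [z] coincide in a forest, and
    this common cover has smaller depth. Hence everything above [x] is a chain, which is why depths
    are bounded by the rank. *)
Lemma forest_up_comparable x y z : (x <= y)%O -> (x <= z)%O -> (y >=< z)%O.
Proof.
have [n] := ubnP (depth x); elim: n x => // n IH x xn.
rewrite le_eqVlt => /predU1P[<- xz|xy]; first by rewrite /Order.comparable xz.
rewrite le_eqVlt => /predU1P[<-|xz].
  by rewrite /Order.comparable (ltW xy) orbT.
have [c xc cy] := exists_cover xy; have [c' xc' cz] := exists_cover xz.
rewrite (forestT xc' xc) in cz; apply: IH cy cz.
by apply: leq_trans (depth_lt xc.1) _.
Qed.

Lemma depth_le_rank x : depth x <= poset_rank T.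
Proof.
rewrite /depth -cardsE; apply: (@leq_bigmax_cond _ _ (fun C : {set T} => #|C|)).
apply/forall_inP => y; rewrite inE => xy; apply/forall_inP => z; rewrite inE.
exact: forest_up_comparable.
Qed.

Lemma rank_le_card : poset_rank T <= #|T|.
Proof. by apply/bigmax_leqP => C _; exact: max_card. Qed.

(** Subtraction is truncated: only the last [n - r] terms contribute, and they sum to (n - r)(n - r
    + 1) / 2. *)
Lemma sum_subr_ge n r : (n - r) ^ 2 <= 2 * \sum_(i < n) (i.+1 - r).
Proof.
elim: n => [|n IH]; first by rewrite big_ord0.
rewrite big_ord_recr /= mulnDr; move: IH; set S := \sum_(_ < _) _ => IH.
have [nr|rn] := ltnP n r; first by rewrite (_ : n.+1 - r = 0) //; lia.
by rewrite subSn//; nia.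
Qed.

(** The numbers [i.+1] sum to the number of unordered pairs, repetitions included, and the hook
    lengths count the comparable ones; the gap is the number of incomparable pairs. Along the depth
    enumeration the depth at index [i] is at most both [i.+1] and the rank. *)
Lemma incomparable_pairs_ge :
  (#|T| - poset_rank T) ^ 2 + 2 * \sum_(x : T) hook_length x <=
    2 * \sum_(i < #|T|) i.+1.
Proof.
rewrite sum_hook_length_depth; have [g gbij gle] := depth_enum.
rewrite (reindex g) /=; last exact: onW_bij.
apply: leq_trans (leq_add (sum_subr_ge _ _) (leqnn _)) _.
rewrite -mulnDr leq_pmul2l// -big_split /=; apply: leq_sum => i _.
have aux a b k : a <= k -> a <= b -> k - b + a <= k by lia.
exact: aux (gle i) (depth_le_rank (g i)).
Qed.

(** The enumeration is now by hook length; the gap proved through depths carries over because it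
    concerns total sums only. Squares of deficits [a i] are converted into a deficit of squares by
    [(k - b) ^ 2 + b ^ 2 <= k ^ 2] for [b <= k]. *)
Lemma hook_length_sqr_gap :
  (#|T| - poset_rank T) ^ 4 + 4 * #|T| * \sum_(x : T) hook_length x ^ 2 <=
    4 * #|T| * \sum_(i < #|T|) i.+1 ^ 2.
Proof.
have := incomparable_pairs_ge; have [g gbij gle] := hook_length_enum.
rewrite !(reindex g (onW_bij _ gbij)) /=.
set n := #|T|; set r := poset_rank T.
pose a (i : 'I_n) := i.+1 - hook_length (g i).
have -> : \sum_(i < n) i.+1 = \sum_i a i + \sum_i hook_length (g i).
  by rewrite -big_split; apply: eq_bigr => i _; exact/esym/subnK/gle.
rewrite mulnDr leq_add2r => H1.
have H2 : (n - r) ^ 4 <= 4 * (n * \sum_i a i ^ 2).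
  apply: leq_trans (leq_mul (leqnn 4) (sqr_sum_le a)).
  by rewrite (expnM _ 2 2); move: H1; rewrite -leq_sqr; lia.
have H3 : \sum_i a i ^ 2 + \sum_i hook_length (g i) ^ 2 <= \sum_(i < n) i.+1 ^ 2.
  rewrite -big_split; apply: leq_sum => i _.
  have aux b k : b <= k -> (k - b) ^ 2 + b ^ 2 <= k ^ 2 by nia.
  exact: aux (gle i).
apply: leq_trans (leq_mul (leqnn (4 * n)) H3).
by rewrite mulnDr leq_add2r -mulnA.
Qed.
End Forest.

Local Open Scope ring_scope.

(** * Divisibility of q-factorials *)

Section QFactorial.
Context (F : fieldType).

Lemma qintD a b : qint F (a + b) = qint F a + 'X^a * qint F b.
Proof.
rewrite /qint big_split_ord /=; congr (_ + _).
by rewrite big_distrr; apply: eq_bigr => i _; rewrite exprD.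
Qed.

Lemma qfactS n : qfact F n.+1 = qfact F n * qint F n.+1.
Proof. by rewrite /qfact big_nat_recr. Qed.

Lemma qfact0 : qfact F 0 = 1.
Proof. by rewrite /qfact big_geq. Qed.

(** Gaussian binomials are polynomials, by the q-Pascal rule: the last factor of the larger
    q-factorial splits as [a+1] + q^(a+1) [b+1]. *)
Lemma dvdp_qfact a b : qfact F a * qfact F b %| qfact F (a + b).
Proof.
have [n] := ubnP (a + b)%N; elim: n a b => // n IH [|a] [|b] abn.
- by rewrite qfact0 mul1r.
- by rewrite qfact0 mul1r.
- by rewrite qfact0 mulr1 addn0.
rewrite [in X in _ %| X]addSn [X in _ %| X]qfactS -addSn qintD mulrDr dvdp_add//.
  have -> : qfact F a.+1 * qfact F b.+1 = (qfact F a * qfact F b.+1) * qint F a.+1.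
    by rewrite [qfact F a.+1]qfactS; ring.
  by apply: dvdp_mul => //; apply: IH; lia.
have -> : qfact F a.+1 * qfact F b.+1 = (qfact F a.+1 * qfact F b) * qint F b.+1.
  by rewrite [qfact F b.+1]qfactS; ring.
rewrite addnS -addSn mulrA dvdp_mul// dvdp_mulr//; apply: IH; lia.
Qed.

Context (d : Order.disp_t) (T : finPOrderType d).
Hypothesis forestT : is_forest T.

(** Down-sets make an induction on cardinality possible. Let [D] be the ideal of a maximal [m] in
    [I]. If [D] is all of [I], removing [m] strips the factor of its hook length [#|I|]; otherwise
    [D] and [I :\: D] are smaller down-sets, recombined by [dvdp_qfact]. *)
Lemma dvdp_prod_qint_hook (I : {set T}) :
  (forall x y : T, (x <= y)%O -> y \in I -> x \in I) ->
  \prod_(u in I) qint F (hook_length u) %| qfact F #|I|.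
Proof.
have [n] := ubnP #|I|; elim: n I => // n IH I In downI.
have [->|[x0 x0I]] := set_0Vmem I; first by rewrite big_set0 dvd1p.
case: (@arg_maxnP _ x0 [in I] (@hook_length d T) x0I) => m /= mI mmax.
have mmaxI t : t \in I -> ~ (m < t)%O.
  by move=> tI /hook_length_lt; rewrite ltnNge; have /= -> := mmax t tI.
pose D := [set t | (t <= m)%O].
have DI : D \subset I by apply/fintype.subsetP => t; rewrite inE => /downI; apply.
have cD : #|D| = hook_length m by rewrite cardsE.
have [ID|ID] := eqVneq D I.
  rewrite (big_setD1 m)//= -ID cD.
  have /prednK <- : (0 < hook_length m)%N.
    by rewrite -cD; apply/card_gt0P; exists m; rewrite inE.
  rewrite qfactS mulrC dvdp_mul//.
  have -> : (hook_length m).-1 = #|D :\ m| by rewrite -cD (cardsD1 m D) inE lexx.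
  apply: IH.
    by rewrite ID; move: In; rewrite (cardsD1 m I) mI.
  move=> x y xy; rewrite !inE => /andP[ym yD].
  rewrite (le_trans xy yD) andbT; apply: contra_neq ym => xm.
  by apply/eqP; rewrite eq_le yD -xm xy.
have cI : (#|I| = #|D| + #|I :\: D|)%N by rewrite -(cardsID D I) (finset.setIidPr DI).
have DltI : (#|D| < #|I|)%N.
  by rewrite proper_card// finset.properEneq ID.
have D0 : (0 < #|D|)%N by apply/card_gt0P; exists m; rewrite inE.
rewrite (big_setID D) /= (finset.setIidPr DI) cI.
apply: dvdp_trans (dvdp_qfact _ _); apply: dvdp_mul; apply: IH.
- by apply: leq_trans DltI _.
- by move=> x y xy; rewrite !inE; exact: le_trans.
- by rewrite -ltnS (leq_trans _ In)// ltnS cI -[ltnLHS]add0n ltn_add2r.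
(* The forest hypothesis enters here: an [x] below both [y] and [m] makes these two comparable, and
   maximality of [m] leaves only [y <= m]. *)
- move=> x y xy; rewrite !inE => /andP[ym yI].
  rewrite (downI _ _ xy yI) andbT; apply: contraNN ym => xm.
  have /orP[//|my] := forest_up_comparable forestT xy xm.
  have /predU1P[->//|/(mmaxI _ yI)//] : (m == y) || (m < y)%O by rewrite -le_eqVlt.
Qed.

Lemma forest_polyM :
  forest_poly F T * \prod_(u : T) qint F (hook_length u) = qfact F #|T|.
Proof.
rewrite /forest_poly; have -> : \prod_(u : T) qint F (hook_length u) =
    \prod_(u in [set: T]) qint F (hook_length u).
  by apply: eq_bigl => u; rewrite inE.
rewrite divpK -?cardsT//; apply: dvdp_prod_qint_hook => x y _ _.
by rewrite inE.
Qed.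

End QFactorial.

(** * Moments and cosine sums of q-integers *)

Section CoefSum.
Context (R : comNzRingType).
Implicit Types (F : nat -> R) (p q : {poly R}).

(** For the law with weights proportional to the coefficients of [p], this is the expectation of [F]
    times [p.[1]]; without the normalization it is linear in [p]. *)
Definition wcoef_sum F p : R := \sum_(j < size p) p`_j * F j.

Lemma wcoef_sum_wide N F p : (size p <= N)%N ->
  wcoef_sum F p = \sum_(j < N) p`_j * F j.
Proof.
move=> pN; rewrite /wcoef_sum (big_ord_widen N (fun j => p`_j * F j) pN).
rewrite big_mkcond; apply: eq_bigr => j _; case: ltnP => // pj.
by rewrite nth_default// mul0r.
Qed.

Lemma wcoef_sumD F p q : wcoef_sum F (p + q) = wcoef_sum F p + wcoef_sum F q.
Proof.
rewrite !(@wcoef_sum_wide (maxn (size p) (size q))) ?leq_maxl ?leq_maxr//.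
  by rewrite -big_split; apply: eq_bigr => j _; rewrite coefD mulrDl.
exact: size_polyD.
Qed.

Lemma wcoef_sum0 F : wcoef_sum F 0 = 0.
Proof. by rewrite /wcoef_sum size_poly0 big_ord0. Qed.

Lemma wcoef_sumZ F c p : wcoef_sum F (c *: p) = c * wcoef_sum F p.
Proof.
rewrite (@wcoef_sum_wide (size p)) ?size_scale_leq// /wcoef_sum mulr_sumr.
by apply: eq_bigr => j _; rewrite coefZ mulrA.
Qed.

Lemma wcoef_sum_sum F I (r : seq I) (P : pred I) (p : I -> {poly R}) :
  wcoef_sum F (\sum_(i <- r | P i) p i) = \sum_(i <- r | P i) wcoef_sum F (p i).
Proof. exact: (big_morph _ (wcoef_sumD F) (wcoef_sum0 F)). Qed.

Lemma wcoef_sumXn F m : wcoef_sum F 'X^m = F m.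
Proof.
rewrite /wcoef_sum size_polyXn big_ord_recr /= coefXn eqxx mul1r big1 ?add0r//.
by move=> j _; rewrite coefXn (ltn_eqF (ltn_ord j)) mul0r.
Qed.

Lemma wcoef_sum_ind (L : {poly R} -> R) :
  L 0 = 0 -> {morph L : p q / p + q} -> (forall c p, L (c *: p) = c * L p) ->
  forall p, L p = wcoef_sum (fun j => L 'X^j) p.
Proof.
move=> L0 LD LZ p; rewrite -{1}[p]coefK poly_def (big_morph _ LD L0).
by apply: eq_bigr => j _; rewrite LZ.
Qed.

Lemma wcoef_sum_one p : p.[1] = wcoef_sum (fun=> 1) p.
Proof. by rewrite horner_coef; apply: eq_bigr => j _; rewrite expr1n. Qed.

Lemma wcoef_sum_id p : p^`().[1] = wcoef_sum (fun j => j%:R) p.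
Proof.
rewrite (@wcoef_sum_ind (fun p => p^`().[1])).
- by apply: eq_bigr => j _; rewrite derivXn hornerMn hornerXn expr1n.
- by rewrite deriv0 horner0.
- by move=> a b; rewrite derivD hornerD.
- by move=> c a; rewrite derivZ hornerZ.
Qed.

Lemma wcoef_sum_sqr p :
  p^`()^`().[1] + p^`().[1] = wcoef_sum (fun j => j%:R ^+ 2) p.
Proof.
rewrite (@wcoef_sum_ind (fun p => p^`()^`().[1] + p^`().[1])).
- apply: eq_bigr => -[[|j] jlt] _ /=; congr (_ * _).
    by rewrite expr0 derivC deriv0 horner0 addr0 expr0n.
  rewrite derivXn derivMn derivXn !hornerMn !hornerXn !expr1n.
  by rewrite /= -mulrnA -mulrnDr -natrX; congr (_%:R); lia.
- by rewrite !deriv0 horner0 addr0.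
- by move=> a b; rewrite !derivD !hornerD; ring.
- by move=> c a; rewrite !derivZ !hornerZ; ring.
Qed.

Lemma wcoef_sumMXn F p i : wcoef_sum F (p * 'X^i) = wcoef_sum (fun j => F (j + i)%N) p.
Proof.
rewrite (@wcoef_sum_ind (fun p => wcoef_sum F (p * 'X^i))).
- by apply: eq_bigr => j _; rewrite -exprD wcoef_sumXn.
- by rewrite mul0r wcoef_sum0.
- by move=> a b; rewrite mulrDl wcoef_sumD.
- by move=> c a; rewrite -scalerAl wcoef_sumZ.
Qed.

End CoefSum.

Section LogDerivatives.
Context (R : realFieldType).
Implicit Types p q : {poly R}.

(** [poly_mean] and [poly_var] are the first two cumulants, the derivatives of log p(e^s) at s = 0.
    They turn products into sums for all polynomials nonzero at 1, so the contributions of the hooks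
    can simply be subtracted. *)
Definition poly_mean p : R := p^`().[1] / p.[1].
Definition poly_var p : R :=
  (p^`()^`().[1] + p^`().[1]) / p.[1] - poly_mean p ^+ 2.

Lemma poly_meanM p q : p.[1] != 0 -> q.[1] != 0 ->
  poly_mean (p * q) = poly_mean p + poly_mean q.
Proof.
by move=> p1 q1; rewrite /poly_mean derivM !hornerE; field; rewrite p1 q1.
Qed.

Lemma poly_varM p q : p.[1] != 0 -> q.[1] != 0 ->
  poly_var (p * q) = poly_var p + poly_var q.
Proof.
move=> p1 q1; rewrite /poly_var /poly_mean !(derivM, derivD) !(hornerM, hornerD).
move: p1 q1; move: p.[1] q.[1] p^`().[1] q^`().[1] p^`()^`().[1] q^`()^`().[1].
by move=> a b c d e f a0 b0; field; rewrite a0 b0.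
Qed.

Lemma poly_mean1 : poly_mean 1 = 0.
Proof. by rewrite /poly_mean -polyC1 derivC horner0 mul0r. Qed.

Lemma poly_var1 : poly_var 1 = 0.
Proof.
by rewrite /poly_var poly_mean1 -polyC1 !derivC horner0 addr0 mul0r expr0n subr0.
Qed.

Lemma wcoef_sum_qint (F : nat -> R) k : wcoef_sum F (qint R k) = \sum_(i < k) F i.
Proof. by rewrite wcoef_sum_sum; apply: eq_bigr => i _; rewrite wcoef_sumXn. Qed.

Lemma qint1 k : (qint R k).[1] = k%:R.
Proof.
by rewrite wcoef_sum_one wcoef_sum_qint sumr_const card_ord.
Qed.

Lemma sum_natr k : \sum_(i < k) (i%:R : R) = k%:R * (k%:R - 1) / 2.
Proof.
elim: k => [|k IH]; first by rewrite big_ord0; ring.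
by rewrite big_ord_recr /= IH -natr1; field.
Qed.

Lemma sum_sqr_natr k :
  \sum_(i < k) (i%:R : R) ^+ 2 = k%:R * (k%:R - 1) * (2 * k%:R - 1) / 6.
Proof.
elim: k => [|k IH]; first by rewrite big_ord0; ring.
by rewrite big_ord_recr /= IH -natr1; field.
Qed.

Lemma poly_mean_qint k : (0 < k)%N -> poly_mean (qint R k) = (k%:R - 1) / 2.
Proof.
move=> k0; rewrite /poly_mean wcoef_sum_id wcoef_sum_qint sum_natr qint1.
by field; rewrite pnatr_eq0 -lt0n.
Qed.

Lemma poly_var_qint k : (0 < k)%N -> poly_var (qint R k) = (k%:R ^+ 2 - 1) / 12.
Proof.
move=> k0; rewrite /poly_var poly_mean_qint// wcoef_sum_sqr wcoef_sum_qint.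
by rewrite sum_sqr_natr qint1; field; rewrite pnatr_eq0 -lt0n.
Qed.

Lemma poly_prod_qint I (r : seq I) (h : I -> nat) : (forall i, (0 < h i)%N) ->
  let D := \prod_(i <- r) qint R (h i) in
  [/\ D.[1] = \prod_(i <- r) (h i)%:R, D.[1] != 0,
      poly_mean D = \sum_(i <- r) ((h i)%:R - 1) / 2 &
      poly_var D = \sum_(i <- r) ((h i)%:R ^+ 2 - 1) / 12].
Proof.
move=> h0 /=; elim: r => [|i r [IH0 IH1 IH2 IH3]].
  by rewrite !big_nil poly_mean1 poly_var1 hornerC oner_neq0.
have hi1 : (qint R (h i)).[1] != 0 by rewrite qint1 pnatr_eq0 -lt0n.
rewrite !big_cons hornerM IH0 qint1 poly_meanM// poly_varM// IH2 IH3.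
rewrite poly_mean_qint// poly_var_qint//; split=> //.
by rewrite mulf_neq0// -?IH0// -qint1.
Qed.

End LogDerivatives.

Section CosineSum.
Context (R : realType).
Implicit Types (t b : R) (p : {poly R}).

(** Real form of a geometric sum of exponentials; keeping [sin (t / 2)] on the left avoids a
    division. *)
Lemma sum_cos_arith t x k : sin (t / 2) * \sum_(i < k) cos (x + i%:R * t) =
  sin (k%:R * t / 2) * cos (x + (k%:R - 1) * t / 2).
Proof.
elim: k => [|k IH]; first by rewrite big_ord0 mulr0 !mul0r sin0 mul0r.
rewrite big_ord_recr /= mulrDr IH -[k.+1%:R]natr1.
have -> : (k%:R + 1) * t / 2 = k%:R * t / 2 + t / 2 by ring.
have -> : x + (k%:R + 1 - 1) * t / 2 = x + k%:R * t / 2 by ring.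
have -> : x + (k%:R - 1) * t / 2 = (x + k%:R * t / 2) - t / 2 by ring.
have -> : x + k%:R * t = (x + k%:R * t / 2) + k%:R * t / 2 by field.
set A := x + k%:R * t / 2.
by rewrite sinD cosB [cos (A + _)]cosD; ring.
Qed.

(** The real part of e^(-ib) p(e^(it)). *)
Definition cos_sum t b p := wcoef_sum (fun j => cos (j%:R * t - b)) p.

Lemma cos_sumM_qint t b p k : sin (t / 2) * cos_sum t b (p * qint R k) =
  sin (k%:R * t / 2) * cos_sum t (b - (k%:R - 1) * t / 2) p.
Proof.
rewrite /cos_sum /qint [p * _]mulr_sumr wcoef_sum_sum.
under eq_bigr do rewrite wcoef_sumMXn.
rewrite /wcoef_sum exchange_big /= !mulr_sumr; apply: eq_bigr => j _.
rewrite -mulr_sumr mulrCA [RHS]mulrCA; congr (_ * _).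
have -> : j%:R * t - (b - (k%:R - 1) * t / 2) = j%:R * t - b + (k%:R - 1) * t / 2.
  by ring.
rewrite -sum_cos_arith; congr (_ * _).
by apply: eq_bigr => i _; rewrite natrD; congr cos; ring.
Qed.

Lemma cos_sumM_prod_qint t b p I (r : seq I) (h : I -> nat) :
  (\prod_(i <- r) sin (t / 2)) * cos_sum t b (p * \prod_(i <- r) qint R (h i)) =
  (\prod_(i <- r) sin ((h i)%:R * t / 2)) *
    cos_sum t (b - (\sum_(i <- r) ((h i)%:R - 1) / 2) * t) p.
Proof.
elim: r p => [|i r IH] p; first by rewrite !big_nil mul0r subr0 !(mulr1, mul1r).
rewrite !big_cons [p * _]mulrA -mulrA IH mulrCA cos_sumM_qint mulrCA mulrA.
by congr (_ * cos_sum _ _ _); field.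
Qed.

Lemma cos_sum1 t b : cos_sum t b 1 = cos b.
Proof. by rewrite /cos_sum -(expr0 'X) wcoef_sumXn mul0r sub0r cosN. Qed.
End CosineSum.

(** * Two-sided exponential bounds for the cardinal sine *)

Section Sinc.
Context (R : realType).
Implicit Types x t : R.

(** Drives the ladder of Taylor inequalities below: each of them is the sign condition on the
    derivative needed for the next. *)
Lemma derive_ge0_ge_init (f f' : R -> R) x :
  (forall y : R, is_derive y 1 f (f' y)) -> (forall y, 0 <= y -> 0 <= f' y) ->
  0 <= x -> f 0 <= f x.
Proof.
move=> df f'0; rewrite le_eqVlt => /predU1P[<-//|x0].
have cf : {within `[0, x], continuous f}%classic.
  by apply: derivable_within_continuous => y _; have [] := df y.
have [c + ] := MVT x0 (fun y _ => df y) cf.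
rewrite in_itv/= => /andP[c0 _] fx; rewrite -subr_ge0 fx subr0.
by rewrite mulr_ge0// ?f'0// ltW.
Qed.

Lemma sin_le_id x : 0 <= x -> sin x <= x.
Proof.
move=> x0; have := @derive_ge0_ge_init (fun y => y - sin y) (fun y => 1 - cos y) x.
rewrite sin0 subr0 subr_ge0; apply => //.
Qed.

Lemma cos_ge_taylor2 x : 0 <= x -> 1 - x ^+ 2 / 2 <= cos x.
Proof.
move=> x0; have := @derive_ge0_ge_init
  (fun y => cos y - (1 - y ^+ 2 / 2)) (fun y => y - sin y) x.
rewrite cos0 expr0n mul0r subr0 subrr subr_ge0; apply => //.
  move=> y; apply: is_derive_eq.
  by rewrite /GRing.scale /=; field.
by move=> y y0; rewrite subr_ge0 sin_le_id.
Qed.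

Lemma sin_ge_taylor3 x : 0 <= x -> x - x ^+ 3 / 6 <= sin x.
Proof.
move=> x0; have := @derive_ge0_ge_init
  (fun y => sin y - (y - y ^+ 3 / 6)) (fun y => cos y - (1 - y ^+ 2 / 2)) x.
rewrite sin0 expr0n mul0r subr0 subrr subr_ge0; apply => //.
  move=> y; apply: is_derive_eq.
  by rewrite /GRing.scale /=; field.
by move=> y y0; rewrite subr_ge0 cos_ge_taylor2.
Qed.

Lemma cos_le_taylor4 x : 0 <= x -> cos x <= 1 - x ^+ 2 / 2 + x ^+ 4 / 24.
Proof.
move=> x0; have := @derive_ge0_ge_init
  (fun y => (1 - y ^+ 2 / 2 + y ^+ 4 / 24) - cos y)
  (fun y => sin y - (y - y ^+ 3 / 6)) x.
rewrite cos0 !expr0n !mul0r subr0 addr0 subrr subr_ge0; apply => //.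
  move=> y; apply: is_derive_eq.
  by rewrite /GRing.scale /=; field.
by move=> y y0; rewrite subr_ge0 sin_ge_taylor3.
Qed.

Lemma sin_le_taylor5 x : 0 <= x -> sin x <= x - x ^+ 3 / 6 + x ^+ 5 / 120.
Proof.
move=> x0; have := @derive_ge0_ge_init
  (fun y => (y - y ^+ 3 / 6 + y ^+ 5 / 120) - sin y)
  (fun y => (1 - y ^+ 2 / 2 + y ^+ 4 / 24) - cos y) x.
rewrite sin0 !expr0n !mul0r subr0 addr0 subrr subr_ge0; apply => //.
  move=> y; apply: is_derive_eq.
  by rewrite /GRing.scale /=; field.
by move=> y y0; rewrite subr_ge0 cos_le_taylor4.
Qed.

Definition sinc x := sin x / x.

Lemma sinc_le_exp x : 0 < x -> sinc x <= expR (- (x ^+ 2 / 6) + x ^+ 4 / 18).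
Proof.
move=> x0; apply: (@le_trans _ _ (1 - x ^+ 2 / 6 + x ^+ 4 / 120)).
  rewrite /sinc ler_pdivrMr//; apply: le_trans (sin_le_taylor5 (ltW x0)) _.
  by lra.
apply: le_trans (expR_ge1Dx _); rewrite addrA lerD2l.
by rewrite ler_pM2l ?exprn_gt0//; lra.
Qed.

Lemma sinc_ge_exp x : 0 < x -> x <= 1 ->
  expR (- (x ^+ 2 / 6) - x ^+ 4 / 18) <= sinc x.
Proof.
move=> x0 x1; apply: (@le_trans _ _ (1 - x ^+ 2 / 6)); last first.
  rewrite /sinc ler_pdivlMr//; apply: le_trans (sin_ge_taylor3 (ltW x0)).
  by lra.
(* The claim becomes [1 - u >= expR (- u - 2 u^2)], and it suffices that
   [(1 + u + 2 u^2) (1 - u) >= 1], true for [u <= 1 / 2]. The constant 18 comes from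
   [2 u^2 = x^4 / 18]. *)
pose u := x ^+ 2 / 6.
have u0 : 0 < u by rewrite divr_gt0// exprn_gt0.
have u1 : u <= 1 / 6.
  by rewrite ler_pM2r// exprn_ile1// ltW.
have u2 : 0 < 1 - u by lra.
have -> : x ^+ 4 / 18 = 2 * u ^+ 2 by rewrite /u; field.
rewrite -/u -opprD expRN -[leRHS]invrK lef_pV2 ?posrE ?expR_gt0 ?invr_gt0//.
apply: le_trans (expR_ge1Dx _); rewrite -div1r ler_pdivrMr//; nra.
Qed.

Lemma sinc_gt0 x : 0 < x -> x <= 1 -> 0 < sinc x.
Proof. by move=> x0 x1; apply: lt_le_trans (sinc_ge_exp x0 x1); exact: expR_gt0. Qed.

End Sinc.

(** * The law attached to a forest *)

Section ForestLaw.
Context (R : realType) (d : Order.disp_t) (T : finPOrderType d).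
Hypothesis forestT : is_forest T.
Local Notation L := (forest_poly R T).
Local Notation n := #|T|.

Lemma hook_length_gt0 (u : T) : (0 < hook_length u)%N.
Proof. by apply/card_gt0P; exists u; rewrite inE. Qed.

Lemma hook_length_le_card (u : T) : (hook_length u <= n)%N.
Proof. exact: max_card. Qed.

Lemma qfactE k : qfact R k = \prod_(i < k) qint R i.+1.
Proof. by rewrite /qfact big_add1 big_mkord. Qed.

Lemma forest_poly1_neq0 : L.[1] != 0.
Proof.
have [_ n1 _ _] := poly_prod_qint R (index_enum 'I_n) (fun i => ltn0Sn i).
move: n1; rewrite -qfactE -(forest_polyM R forestT) hornerM.
by rewrite mulf_eq0 negb_or => /andP[].
Qed.

Lemma forest_poly1 : L.[1] * \prod_(u : T) (hook_length u)%:R = \prod_(i < n) i.+1%:R.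
Proof.
have [<- _ _ _] := poly_prod_qint R (index_enum 'I_n) (fun i => ltn0Sn i).
have [<- _ _ _] := poly_prod_qint R (index_enum T) hook_length_gt0.
by rewrite -hornerM forest_polyM// qfactE.
Qed.

Lemma forest_poly_mean : poly_mean L =
  \sum_(i < n) (i.+1%:R - 1) / 2 - \sum_(u : T) ((hook_length u)%:R - 1) / 2.
Proof.
have [_ _ <- _] := poly_prod_qint R (index_enum 'I_n) (fun i => ltn0Sn i).
have [_ D1 <- _] := poly_prod_qint R (index_enum T) hook_length_gt0.
by rewrite -qfactE -(forest_polyM R forestT) poly_meanM ?forest_poly1_neq0// addrK.
Qed.

Lemma forest_poly_var : poly_var L =
  (\sum_(i < n) i.+1%:R ^+ 2 - \sum_(u : T) (hook_length u)%:R ^+ 2) / 12.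
Proof.
have [_ _ _ v1] := poly_prod_qint R (index_enum 'I_n) (fun i => ltn0Sn i).
have [_ D1 _ v2] := poly_prod_qint R (index_enum T) hook_length_gt0.
move: v1; rewrite -qfactE -(forest_polyM R forestT) poly_varM ?forest_poly1_neq0//.
rewrite v2 -!mulr_suml !sumrB !sumr_const card_ord => v1; lra.
Qed.

(** The constant is 48 = 4 * 12: the 4 of [hook_length_sqr_gap] and the 12 in the variance of a
    uniform variable on an integer interval. *)
Lemma forest_poly_var_ge :
  ((n - poset_rank T)%N%:R ^+ 4 : R) <= 48 * n%:R * poly_var L.
Proof.
rewrite forest_poly_var; have := hook_length_sqr_gap forestT.
rewrite -(ler_nat R) natrD natrX !natrM !natr_sum.
under eq_bigr do rewrite natrX; under [X in _ <= _ * X]eq_bigr do rewrite natrX.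
move: (\sum_(_ < _) _) (\sum_(_ : T) _) => a b; nra.
Qed.

(** Product formula for the centred characteristic function, which is real because every q-integer
    is symmetric about its mean. *)
Definition forest_cf (t : R) : R := \prod_(i < n) sinc (i.+1%:R * t / 2) /
  \prod_(u : T) sinc ((hook_length u)%:R * t / 2).

Lemma forest_cos_sum t b : 0 < t -> n%:R * t <= 2 ->
  cos_sum t b L / L.[1] = cos (poly_mean L * t - b) * forest_cf t.
Proof.
rewrite /forest_cf.
move=> t0 nt.
have xgt0 k : (0 < k)%N -> 0 < k%:R * t / 2.
  by move=> k0; rewrite divr_gt0// mulr_gt0// ltr0n.
have xle1 k : (k <= n)%N -> k%:R * t / 2 <= 1.
  move=> kn; rewrite ler_pdivrMr// mul1r; apply: le_trans nt.
  by rewrite ler_pM2r// ler_nat.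
have sinE k : (0 < k)%N -> sin (k%:R * t / 2) = sinc (k%:R * t / 2) * k%:R * (t / 2).
  move=> k0; have x0 := lt0r_neq0 (xgt0 _ k0).
  have -> : sinc (k%:R * t / 2) * k%:R * (t / 2) = sinc (k%:R * t / 2) * (k%:R * t / 2).
    by ring.
  by rewrite /sinc divfK.
(* [cos_sum t bb] of the q-factorial is computed twice, as [L] times the hook factors and as 1 times
   the factors [1], ..., [n]. The shift in [bb] is the one consumed by the hook factors, so that the
   phase left on [L] is [b]. *)
pose bb := b + (\sum_(u : T) ((hook_length u)%:R - 1) / 2) * t.
have E1 := cos_sumM_prod_qint t bb L (index_enum T) (@hook_length d T).
have E2 := cos_sumM_prod_qint t bb 1 (index_enum 'I_n) (fun i => i.+1).
rewrite /= forest_polyM// addrK in E1.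
rewrite /= mul1r -qfactE cos_sum1 in E2.
rewrite !prodr_const card_ord in E1 E2.
rewrite E1 in E2.
have -> : cos (poly_mean L * t - b) =
    cos (bb - (\sum_(i < n) (i.+1%:R - 1) / 2) * t).
  by rewrite -[RHS]cosN forest_poly_mean /bb; congr cos; ring.
move: E2; set c := cos (bb - _) => E2.
have P1 : \prod_(u : T) sin ((hook_length u)%:R * t / 2) =
    \prod_(u : T) sinc ((hook_length u)%:R * t / 2) *
    \prod_(u : T) (hook_length u)%:R * (t / 2) ^+ n.
  rewrite -prodr_const -!big_split; apply: eq_bigr => u _.
  exact/sinE/hook_length_gt0.
have P2 : \prod_(i < n) sin (i.+1%:R * t / 2) =
    \prod_(i < n) sinc (i.+1%:R * t / 2) *
    \prod_(i < n) i.+1%:R * (t / 2) ^+ n.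
  rewrite -[X in _ ^+ X]card_ord -prodr_const -!big_split.
  by apply: eq_bigr => i _; exact: sinE.
(* The bound [n t <= 2] puts all arguments in ]0, 1], where [sinc] is positive. *)
have A0 : \prod_(u : T) sinc ((hook_length u)%:R * t / 2) != 0.
  apply/prodf_neq0 => u _; apply/lt0r_neq0/sinc_gt0.
    exact/xgt0/hook_length_gt0.
  exact/xle1/hook_length_le_card.
have H0 : \prod_(u : T) ((hook_length u)%:R : R) != 0.
  by apply/prodf_neq0 => u _; rewrite pnatr_eq0 -lt0n hook_length_gt0.
have t20 : (t / 2) ^+ n != 0 by rewrite expf_neq0// lt0r_neq0// divr_gt0.
move: E2; rewrite P1 P2 -forest_poly1; have := forest_poly1_neq0.
set H := \prod_(u : T) (hook_length u)%:R in H0 *.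
set A := \prod_(u : T) _ in A0 *; set B := \prod_(i < n) _.
set C := cos_sum _ _ _; set tau := _ ^+ n in t20 *; set l := L.[1] => l0 E2.
have E3 : A * C = B * l * c.
  apply: (mulfI (mulf_neq0 H0 t20)); move: E2 => E2; lra.
by apply: (mulfI A0); rewrite [LHS]mulrA E3; field; rewrite l0 A0.
Qed.

(** At x = k t / 2 the exponents of [sinc] are - t^2 k^2 / 24, which add up to the variance term,
    and an error of at most t^4 n^4 / 288. The n factors above and the n below the fraction bar give
    2 n such errors. *)
Lemma forest_cf_bounds t : 0 < t -> n%:R * t <= 2 ->
  expR (- (poly_var L * t ^+ 2 / 2) - t ^+ 4 * n%:R ^+ 5 / 144) <= forest_cf t <=
  expR (- (poly_var L * t ^+ 2 / 2) + t ^+ 4 * n%:R ^+ 5 / 144).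
Proof.
move=> t0 nt.
have xgt0 k : (0 < k)%N -> 0 < k%:R * t / 2.
  by move=> k0; rewrite divr_gt0// mulr_gt0// ltr0n.
have xle1 k : (k <= n)%N -> k%:R * t / 2 <= 1.
  move=> kn; rewrite ler_pdivrMr// mul1r; apply: le_trans nt.
  by rewrite ler_pM2r// ler_nat.
have bnd k : (0 < k <= n)%N ->
    expR (- (t ^+ 2 / 24 * k%:R ^+ 2) - t ^+ 4 * n%:R ^+ 4 / 288) <=
      sinc (k%:R * t / 2) <=
    expR (- (t ^+ 2 / 24 * k%:R ^+ 2) + t ^+ 4 * n%:R ^+ 4 / 288).
  move=> /andP[k0 kn]; have x0 := xgt0 _ k0; have x1 := xle1 _ kn.
  have kn4 : (k%:R * t / 2) ^+ 4 / 18 <= t ^+ 4 * n%:R ^+ 4 / 288.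
    have -> : (k%:R * t / 2) ^+ 4 / 18 = t ^+ 4 * k%:R ^+ 4 / 288 :> R by field.
    rewrite ler_pM2r// ler_pM2l ?exprn_gt0//.
    by rewrite lerXn2r ?nnegrE ?ler0n ?ler_nat.
  have -> : t ^+ 2 / 24 * k%:R ^+ 2 = (k%:R * t / 2) ^+ 2 / 6 by field.
  apply/andP; split.
    by apply: le_trans (sinc_ge_exp x0 x1); rewrite ler_expR; lra.
  by apply: le_trans (sinc_le_exp x0) _; rewrite ler_expR; lra.
pose E s k : R := expR (- (t ^+ 2 / 24 * k%:R ^+ 2) + s * (t ^+ 4 * n%:R ^+ 4 / 288)).
have prodE (I : finType) (h : I -> nat) s : #|I| = n ->
    \prod_(i : I) E s (h i) = expR (- (t ^+ 2 / 24 * \sum_(i : I) (h i)%:R ^+ 2) +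
      s * (t ^+ 4 * n%:R ^+ 5 / 288)).
  move=> cI; rewrite -expR_sum big_split /= sumr_const cI sumrN -mulr_sumr.
  by congr (expR (_ + _)); rewrite -mulr_natr; field.
have prodb (I : finType) (h : I -> nat) : #|I| = n -> (forall i, 0 < h i <= n)%N ->
    \prod_(i : I) E (-1) (h i) <= \prod_(i : I) sinc ((h i)%:R * t / 2)
      <= \prod_(i : I) E 1 (h i).
  move=> cI hI; apply/andP; split; apply: ler_prod => i _.
    by rewrite expR_ge0 /E mulN1r; have /andP[] := bnd _ (hI i).
  rewrite /E mul1r; have /andP[_ ->] := bnd _ (hI i); rewrite andbT ltW//.
  have /andP[h0 hn] := hI i.
  by apply: sinc_gt0; [exact: xgt0|exact: xle1].
have hI (u : T) : (0 < hook_length u <= n)%N.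
  by rewrite hook_length_gt0 hook_length_le_card.
have /andP[] := prodb T (@hook_length d T) erefl hI; rewrite !prodE//.
have /andP[] := prodb 'I_n (fun i => i.+1) (card_ord n) (fun i => ltn_ord i).
rewrite !prodE ?card_ord// /forest_cf.
move: (\prod_(i < n) _) (\prod_(u : T) _) => B A B1 B2 A1 A2.
have A0 : 0 < A by apply: lt_le_trans A1; exact: expR_gt0.
rewrite ler_pdivlMr// ler_pdivrMr//; apply/andP; split.
  apply: le_trans B1; apply: le_trans (ler_wpM2l (expR_ge0 _) A2) _.
  by rewrite -expRD ler_expR forest_poly_var; lra.
apply: le_trans B2 _; apply: le_trans (ler_wpM2l (expR_ge0 _) A1).
by rewrite -expRD ler_expR forest_poly_var; lra.
Qed.
End ForestLaw.

Local Open Scope classical_set_scope.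
Local Open Scope ring_scope.

(** * Convergence of cosine transforms *)

Section StepPolynomial.
Context (R : realType).

(** Bernoulli's inequality, and its counterpart from [(1 - u) (1 + (m + 1) u) <= 1 + m u]. They show
    that the power is near 1 for small [m u] and near 0 for large [m u]. *)
Lemma bernoulli_exp_bounds (u : R) m : 0 <= u <= 1 ->
  1 - m%:R * u <= (1 - u) ^+ m /\ (1 - u) ^+ m * (1 + m%:R * u) <= 1.
Proof.
move=> /andP[u0 u1]; elim: m => [|m [IH1 IH2]].
  by rewrite mul0r subr0 addr0 expr0 mulr1.
have m0 : 0 <= (m%:R : R) by rewrite ler0n.
have e0 : 0 <= (1 - u) ^+ m by rewrite exprn_ge0// subr_ge0.
rewrite exprS -natr1; split; first by nra.
apply: le_trans IH2; rewrite mulrAC mulrC ler_wpM2l//; nra.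
Qed.

(* The polynomials (1 - s^N)^m, with m a^N small and m b^N large. *)
Lemma step_polynomial (a b e : R) : 0 < a -> a < b -> b <= 1 -> 0 < e ->
  exists p : {poly R}, forall s, 0 <= s <= 1 ->
    [/\ 0 <= p.[s] <= 1, s <= a -> 1 - e <= p.[s] & b <= s -> p.[s] <= e].
Proof.
move=> a0 ab b1 e0; have b0 := lt_trans a0 ab.
have a1 : a < 1 by exact: lt_le_trans b1.
have ra : `|a| < 1 by rewrite gtr0_norm.
have rab : `|a / b| < 1.
  by rewrite gtr0_norm ?divr_gt0// ltr_pdivrMr// mul1r.
have e2 : 0 < e ^+ 2 / 2 by rewrite divr_gt0// exprn_gt0.
have /cvgrPdist_lt/(_ _ e0) [N1 _ HN1] := cvg_expr ra.
have /cvgrPdist_lt/(_ _ e2) [N2 _ HN2] := cvg_expr rab.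
pose N := maxn N1 N2.
have {HN1} aN : a ^+ N < e.
  have /= := HN1 N (leq_maxl _ _); rewrite sub0r normrN normrX gtr0_norm//.
have {HN2} abN : a ^+ N < b ^+ N * (e ^+ 2 / 2).
  have /= := HN2 N (leq_maxr _ _); rewrite sub0r normrN normrX gtr0_norm ?divr_gt0//.
  by rewrite expr_div_n ltr_pdivrMr ?exprn_gt0// mulrC.
have aN0 : 0 < a ^+ N by rewrite exprn_gt0.
have bN0 : 0 < b ^+ N by rewrite exprn_gt0.
(* Rounding down gives [m a^N <= e], which settles the side [s <= a]. As [m >= 1], also
   [e < 2 m a^N < m b^N e^2], so [e m b^N > 1], which settles [b <= s]; hence the threshold
   [e ^+ 2 / 2] above. *)
pose m := Num.truncn (e / a ^+ N).
have /andP[m1 m2] := truncn_itv (ltW (divr_gt0 e0 aN0)).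
rewrite -/m in m1 m2.
have mge1 : 1 <= (m%:R : R).
  by rewrite ler1n truncn_gt0 ler_pdivlMr// mul1r ltW.
rewrite ler_pdivlMr// in m1.
rewrite ltr_pdivrMr// -natr1 in m2.
exists ((1 - 'X ^+ N) ^+ m) => s /andP[s0 s1].
rewrite horner_exp hornerD hornerN hornerXn hornerC.
have sN0 : 0 <= s ^+ N by rewrite exprn_ge0.
have sN1 : s ^+ N <= 1 by rewrite exprn_ile1.
have sN : 0 <= s ^+ N <= 1 by rewrite sN0.
have [B1 B2] := bernoulli_exp_bounds m sN.
split.
- by rewrite exprn_ge0 ?exprn_ile1 ?subr_ge0//; lra.
- move=> sa; apply: le_trans B1; rewrite lerD2l lerN2.
  apply: le_trans m1; rewrite ler_pM2l; last by lra.
  by rewrite lerXn2r ?nnegrE// ltW.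
- move=> bs; have bsN : b ^+ N <= s ^+ N by rewrite lerXn2r ?nnegrE// ltW.
  have big : 1 <= e * (m%:R * s ^+ N).
    apply: (@le_trans _ _ (e * (m%:R * b ^+ N))); last first.
      by rewrite ler_pM2l// ler_pM2l//; lra.
    have : e < 2 * m%:R * a ^+ N by nra.
    have : 2 * m%:R * a ^+ N < 2 * m%:R * (b ^+ N * (e ^+ 2 / 2)).
      by rewrite ltr_pM2l//; lra.
    move=> h1 h2; rewrite -(ler_pM2l e0); nra.
  have e1 : 0 <= (1 - s ^+ N) ^+ m by rewrite exprn_ge0 ?subr_ge0.
  nra.
Qed.

(* A step function is squeezed, up to a weight growing linearly, between
   polynomials in sin (c y), which is monotone for |c y| <= 1. *)
Lemma trig_step (x x' e : R) : x < x' -> 0 < e ->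
  exists (c : R) (p : {poly R}), forall y : R,
    \1_`]-oo, x] y - e * (1 + `|y|) <= p.[sin (c * y)] <=
    \1_`]-oo, x'] y + e * (1 + `|y|).
Proof.
move=> xx' e0.
(* By [c <= e], a [y] with [|c y| > 1] has error weight at least 1, so both bounds are trivial
   there. The other bound on [c] places [c x] and [c x'] in ]-1, 1[, where the sine is
   increasing. *)
pose c := Num.min e (1 + `|x| + `|x'|)^-1.
have D0 : 0 < 1 + `|x| + `|x'| by rewrite -addrA ltr_pwDl// addr_ge0.
have c0 : 0 < c by rewrite lt_min e0 invr_gt0.
have ce : c <= e by rewrite ge_min lexx.
have cD : c * (1 + `|x| + `|x'|) <= 1.
  have cV : c <= (1 + `|x| + `|x'|)^-1 by rewrite ge_min lexx orbT.
  by rewrite -ler_pdivlMr// div1r.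
have pi2 : 1 <= (pi : R) / 2 by rewrite ler_pdivlMr// mul1r pi_ge2.
have smono : {in `[-1, 1] &, {mono (@sin R) : u v / u < v}}.
  move=> u v; rewrite !in_itv/= => /andP[u1 u2] /andP[v1 v2].
  by apply: ltr_sin; rewrite in_itv/=; apply/andP; split; lra.
have cx : `|c * x| < 1.
  rewrite normrM gtr0_norm//; have := normr_ge0 x; have := normr_ge0 x'; nra.
have cx' : `|c * x'| < 1.
  rewrite normrM gtr0_norm//; have := normr_ge0 x; have := normr_ge0 x'; nra.
have sx : -1 < sin (c * x).
  move: cx; rewrite ltr_norml => /andP[cx1 cx2].
  rewrite -(@sin_pihalf R) -sinN ltr_sin ?in_itv/=; first by lra.
    by lra.
  by apply/andP; split; lra.
(* The sine is rescaled to [0, 1], the domain of [step_polynomial]. *)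
pose sg (y : R) := (1 + sin (c * y)) / 2.
have sgab : sg x < sg x'.
  rewrite ltr_pM2r// ltrD2l smono ?ltr_pM2l// in_itv/= -ler_norml ltW//.
have sg01 y : 0 <= sg y <= 1.
  rewrite /sg; have := sin_le1 (c * y); have := sin_geN1 (c * y); lra.
have sgx0 : 0 < sg x by rewrite divr_gt0// -ltrBlDl sub0r.
have [q Hq] := step_polynomial sgx0 sgab (proj2 (andP (sg01 x'))) e0.
exists c, (q \Po ((2^-1)%:P * (1 + 'X))); move=> y.
have -> : (q \Po ((2^-1)%:P * (1 + 'X))).[sin (c * y)] = q.[sg y].
  by rewrite horner_comp !hornerE /sg [in RHS]mulrC.
have [/andP[q0 q1] qlo qhi] := Hq _ (sg01 y).
have ey : 0 <= e * `|y| by rewrite mulr_ge0// ltW.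
have [cy|cy] := leP `|c * y| 1; last first.
  have {}cy : 1 <= e * `|y|.
    apply: le_trans (ltW cy) _; rewrite normrM gtr0_norm//.
    by rewrite ler_wpM2r.
  by rewrite !indicE; case: (y \in _); case: (y \in _) => /=; lra.
have yI : c * y \in `[-1, 1] by rewrite in_itv/= -ler_norml.
have xI : c * x \in `[-1, 1] by rewrite in_itv/= -ler_norml ltW.
have x'I : c * x' \in `[-1, 1] by rewrite in_itv/= -ler_norml ltW.
have sgle u v : c * u \in `[-1, 1] -> c * v \in `[-1, 1] -> u <= v -> sg u <= sg v.
  move=> uI vI uv; rewrite ler_pM2r// lerD2l leNgt smono// -leNgt ler_pM2l//.
rewrite !indicE !mem_setE !in_itv /=.
have [yx|xy] := leP y x.
  have := qlo (sgle _ _ yI xI yx); rewrite (le_trans yx (ltW xx')) /=; lra.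
have [yx'|x'y] := leP y x' => /=; first lra.
by have := qhi (sgle _ _ x'I yI (ltW x'y)); lra.
Qed.

End StepPolynomial.

Section ContinuityTheorem.
Context (R : realType).
Implicit Types (mu : probability (measurableTypeR R) R) (f : R -> R).

Lemma continuous_bounded_integrable mu f M : continuous f ->
  (forall x, `|f x| <= M) -> mu.-integrable setT (EFin \o f).
Proof.
move=> cf fM; apply: measurable_bounded_integrable => //.
- by rewrite (le_lt_trans (probability_le1 mu measurableT)) ?ltry.
- exact: continuous_measurable_fun.
- exists M; split; first by rewrite num_real.
  by move=> M' MM' x _; exact: le_trans (ltW MM').
Qed.

Lemma continuous_sinM c : continuous (fun x : R => sin (c * x)).
Proof.
move=> x; apply: continuous_comp; last exact: continuous_sin.
exact: mulrl_continuous.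
Qed.

Lemma continuous_cosMB a b : continuous (fun x : R => cos (a * x - b)).
Proof.
move=> x; apply: continuous_comp; last exact: continuous_cos.
by apply: cvgB; [exact: mulrl_continuous|exact: cvg_cst].
Qed.

Lemma integrable_trig mu (p : {poly R}) c a b :
  mu.-integrable setT (EFin \o (fun x => p.[sin (c * x)] * cos (a * x - b))).
Proof.
apply: (@continuous_bounded_integrable _ _ (\sum_(i < size p) `|p`_i|)).
  move=> x; apply: cvgM; last exact: continuous_cosMB.
  apply: (@continuous_comp _ _ _ (fun x => sin (c * x)) (horner p)).
    exact: continuous_sinM.
  exact: continuous_horner.
move=> x; rewrite normrM -[leRHS]mulr1 ler_pM// ?cos_max//.
rewrite horner_coef; apply: le_trans (ler_norm_sum _ _ _) _.
apply: ler_sum => i _; rewrite normrM -[leRHS]mulr1 ler_wpM2l//.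
by rewrite normrX exprn_ile1// sin_max.
Qed.

(** Product-to-sum formula for [sin (c x) cos (a x - b)], with the resulting sines rewritten as
    cosines of shifted phase. *)
Lemma integral_trigMX mu (p : {poly R}) (r c a b : R) :
  \int[mu]_x ((p * 'X + r%:P).[sin (c * x)] * cos (a * x - b)) =
  2^-1 * (\int[mu]_x (p.[sin (c * x)] * cos ((a + c) * x - (b + pi / 2))) +
          \int[mu]_x (p.[sin (c * x)] * cos ((c - a) * x - (pi / 2 - b)))) +
  r * \int[mu]_x (1.[sin (c * x)] * cos (a * x - b)).
Proof.
have i1 := integrable_trig mu p c (a + c) (b + pi / 2).
have i2 := integrable_trig mu p c (c - a) (pi / 2 - b).
have i3 := integrable_trig mu 1 c a b.
rewrite -RintegralD// -!RintegralZl//; last exact: integrableD i1 i2.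
rewrite -RintegralD//; last 2 first.
- exact: (@integrableZl _ _ _ _ _ measurableT (2^-1) _ (integrableD measurableT i1 i2)).
- exact: (@integrableZl _ _ _ _ _ measurableT r _ i3).
apply: eq_Rintegral => x _; rewrite hornerD hornerM hornerX !hornerC.
have -> : cos ((a + c) * x - (b + pi / 2)) = sin (c * x + (a * x - b)).
  by rewrite -cosBpihalf; congr cos; ring.
have -> : cos ((c - a) * x - (pi / 2 - b)) = sin (c * x - (a * x - b)).
  by rewrite -cosBpihalf; congr cos; ring.
by rewrite sinD [sin (_ - (a * x - b))]sinB; field.
Qed.

(** The cosine factor strengthens the induction on [p]: each factor 'X changes both frequency and
    phase, so [a] and [b] stay general. *)
Lemma cvg_integral_trig mu (nu : nat -> probability (measurableTypeR R) R) c :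
  (forall a b, \int[nu n]_x cos (a * x - b) @[n --> \oo] -->
     \int[mu]_x cos (a * x - b)) ->
  forall (p : {poly R}) a b,
    \int[nu n]_x (p.[sin (c * x)] * cos (a * x - b)) @[n --> \oo] -->
    \int[mu]_x (p.[sin (c * x)] * cos (a * x - b)).
Proof.
move=> cvgcos; elim/poly_ind => [a b|p r IH a b].
  have int0 (m : probability (measurableTypeR R) R) :
      \int[m]_x ((0 : {poly R}).[sin (c * x)] * cos (a * x - b)) = 0.
    by under eq_Rintegral do rewrite horner0 mul0r; rewrite Rintegral_cst// mul0r.
  by under eq_fun do rewrite int0; rewrite int0; exact: cvg_cst.
under eq_fun do rewrite integral_trigMX.
rewrite integral_trigMX; apply: cvgD.
  by apply: cvgM; [exact: cvg_cst|apply: cvgD; exact: IH].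
apply: cvgM; first exact: cvg_cst.
have int1 (m : probability (measurableTypeR R) R) :
      \int[m]_x ((1 : {poly R}).[sin (c * x)] * cos (a * x - b)) =
    \int[m]_x cos (a * x - b).
  by apply: eq_Rintegral => x _; rewrite hornerC mul1r.
by under eq_fun do rewrite int1; rewrite int1; exact: cvgcos.
Qed.

Lemma cvg_integral_poly_sin mu (nu : nat -> probability (measurableTypeR R) R) c :
  (forall a b, \int[nu n]_x cos (a * x - b) @[n --> \oo] -->
     \int[mu]_x cos (a * x - b)) ->
  forall p : {poly R},
    \int[nu n]_x p.[sin (c * x)] @[n --> \oo] --> \int[mu]_x p.[sin (c * x)].
Proof.
move=> cvgcos p; have := @cvg_integral_trig mu nu c cvgcos p 0 0.
have int0 (m : probability (measurableTypeR R) R) :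
    \int[m]_x (p.[sin (c * x)] * cos (0 * x - 0)) =
    \int[m]_x p.[sin (c * x)].
  by apply: eq_Rintegral => x _; rewrite mul0r subr0 cos0 mulr1.
by under eq_fun do rewrite int0; rewrite int0.
Qed.

Lemma integrable_poly_sin mu (p : {poly R}) c :
  mu.-integrable setT (EFin \o (fun x => p.[sin (c * x)])).
Proof.
have := integrable_trig mu p c 0 0; apply: eq_integrable => // x _ /=.
by rewrite mul0r subr0 cos0 mulr1.
Qed.

Lemma Rintegral_itvNyc mu (x : R) :
  \int[mu]_y \1_`]-oo, x] y = fine (mu `]-oo, x]%classic).
Proof. by rewrite /Rintegral integral_indic// setIT. Qed.

Lemma integral_trig_step mu (x x' e C c : R) (p : {poly R}) :
  (forall y : R,
    \1_`]-oo, x] y - e * (1 + `|y|) <= p.[sin (c * y)] <=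
    \1_`]-oo, x'] y + e * (1 + `|y|)) ->
  0 < e -> mu.-integrable setT (EFin \o (@Num.norm R R)) -> \int[mu]_y `|y| <= C ->
  fine (mu `]-oo, x]%classic) - e * (1 + C) <= \int[mu]_y p.[sin (c * y)] <=
  fine (mu `]-oo, x']%classic) + e * (1 + C).
Proof.
move=> pb e0 imu muC.
have i1 z : mu.-integrable setT (EFin \o (\1_`]-oo, z] : R -> R)).
  by apply: integrable_indic => //; rewrite (le_lt_trans (probability_le1 mu _)) ?ltry.
have ic : mu.-integrable setT (EFin \o (cst 1 : R -> R)).
  apply: (@continuous_bounded_integrable _ _ 1) => [x0|x0].
    exact: cvg_cst.
  by rewrite normr1.
have iw : mu.-integrable setT (EFin \o (fun y : R => e * (1 + `|y|))).
  exact: (@integrableZl _ _ _ _ _ measurableT e _ (integrableD measurableT ic imu)).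
have wle : \int[mu]_y (e * (1 + `|y|)) <= e * (1 + C).
  rewrite RintegralZl//; last exact: (integrableD measurableT ic imu).
  rewrite ler_pM2l// RintegralD// Rintegral_cst// mul1r.
  by rewrite (congr1 fine (probability_setT mu)) lerD2l.
have ip := integrable_poly_sin mu p c.
apply/andP; split.
- apply: le_trans (_ : \int[mu]_y (\1_`]-oo, x] y - e * (1 + `|y|)) <= _).
    by rewrite RintegralB// Rintegral_itvNyc lerB.
  apply: le_Rintegral => //; first exact: (integrableB measurableT (i1 x) iw).
  by move=> y _; have /andP[] := pb y.
- apply: (@le_trans _ _ (\int[mu]_y (\1_`]-oo, x'] y + e * (1 + `|y|)))); last first.
    by rewrite RintegralD// Rintegral_itvNyc lerD2l.
  apply: le_Rintegral => //; first exact: (integrableD measurableT (i1 x') iw).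
  by move=> y _; have /andP[] := pb y.
Qed.

Theorem cos_transform_continuity mu (nu : nat -> probability (measurableTypeR R) R) C :
  (forall a b, \int[nu n]_x cos (a * x - b) @[n --> \oo] -->
     \int[mu]_x cos (a * x - b)) ->
  mu.-integrable setT (EFin \o (@Num.norm R R)) ->
  (\forall n \near \oo, (nu n).-integrable setT (EFin \o (@Num.norm R R)) /\
     \int[nu n]_y `|y| <= C) ->
  forall x : R, {for x, continuous (fun r : R => mu `]-oo, r]%classic)} ->
    nu n `]-oo, x]%classic @[n --> \oo] --> mu `]-oo, x]%classic.
Proof.
move=> cvgcos imu inu x cx.
have ffin (m : probability (measurableTypeR R) R) (z : R) :
    m `]-oo, z]%classic \is a fin_num.
  exact: fin_num_measure.
rewrite -(fineK (ffin mu x)); apply/fine_cvgP; split.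
  by apply: nearW => n; exact: ffin.
have cfx : fine (mu `]-oo, r]%classic) @[r --> x] --> fine (mu `]-oo, x]%classic).
  by apply: fine_cvg; rewrite fineK.
pose C' := Num.max C (\int[mu]_y `|y|).
have C'0 : 0 <= C' by rewrite le_max Rintegral_ge0 ?orbT.
apply/cvgrPdist_le => e e0.
(* One share for continuity of the limit at [x], one for convergence of the trigonometric integrals,
   and two for the squeeze, under [mu] and under [nu n]. The polynomial [p1] steps down just before
   [x], [p2] just after. *)
pose h := e / 4; have h0 : 0 < h by rewrite divr_gt0.
have /cvgrPdist_lt/(_ _ h0)/nbhs_ballP[/= r r0 Hr] := cfx.
pose k := h / (1 + C').
have k0 : 0 < k by rewrite divr_gt0// ltr_pwDl.
have kC : k * (1 + C') = h by rewrite divfK// lt0r_neq0// ltr_pwDl.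
have near_lt (z : R) : `|x - z| < r ->
    `|fine (mu `]-oo, x]%classic) - fine (mu `]-oo, z]%classic)| < h.
  by move=> xz; apply: Hr.
have F1 : `|fine (mu `]-oo, x]%classic) - fine (mu `]-oo, (x - r / 2)]%classic)| < h.
  by apply: near_lt; rewrite opprB addrC subrK gtr0_norm; lra.
have F2 : `|fine (mu `]-oo, x]%classic) - fine (mu `]-oo, (x + r / 2)]%classic)| < h.
  by apply: near_lt; rewrite opprD addNKr normrN gtr0_norm; lra.
have x1x : x - r / 2 < x by lra.
have xx2 : x < x + r / 2 by lra.
have [c1 [p1 P1]] := trig_step x1x k0; have [c2 [p2 P2]] := trig_step xx2 k0.
have muC : \int[mu]_y `|y| <= C' by rewrite le_max lexx orbT.
have /andP[A1 A2] := integral_trig_step P1 k0 imu muC.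
have /andP[B1 B2] := integral_trig_step P2 k0 imu muC.
rewrite kC in A1 A2 B1 B2.
have /cvgrPdist_lt/(_ _ h0) N1 := @cvg_integral_poly_sin mu nu c1 cvgcos p1.
have /cvgrPdist_lt/(_ _ h0) N2 := @cvg_integral_poly_sin mu nu c2 cvgcos p2.
near=> n.
have [in1 in2] : (nu n).-integrable setT (EFin \o (@Num.norm R R)) /\
     \int[nu n]_y `|y| <= C by near: n.
have nuC : \int[nu n]_y `|y| <= C' by rewrite le_max in2.
have /andP[A3 A4] := integral_trig_step P1 k0 in1 nuC.
have /andP[B3 B4] := integral_trig_step P2 k0 in1 nuC.
rewrite kC in A3 A4 B3 B4.
have D1 : `|\int[mu]_y p1.[sin (c1 * y)] - \int[nu n]_y p1.[sin (c1 * y)]| < h.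
  by near: n.
have D2 : `|\int[mu]_y p2.[sin (c2 * y)] - \int[nu n]_y p2.[sin (c2 * y)]| < h.
  by near: n.
move: F1 F2 D1 D2; rewrite /= !ltr_norml ler_norml.
move=> /andP[? ?] /andP[? ?] /andP[? ?] /andP[? ?].
have eh : e = 4 * h by rewrite /h mulrC divfK.
by rewrite eh; apply/andP; split; lra.
Unshelve. all: end_near. Qed.

End ContinuityTheorem.

(** * The cosine transform of the normal law *)

Section NormalIntegral.
Context (R : realType) (m s : R).
Local Notation leb := (@lebesgue_measure R).

(** Integrals are transported to Lebesgue measure through the abstract Radon-Nikodym derivative,
    which is recognised here as the Gaussian density since both have the same integrals over
    measurable sets. *)
Lemma Radon_Nikodym_normal_prob :
  ae_eq leb setT
    (Radon_Nikodym_SigmaFinite.f (normal_prob m s) leb)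
    (EFin \o normal_pdf m s).
Proof.
apply: integral_ae_eq => //.
- exact/Radon_Nikodym_SigmaFinite.f_integrable/normal_prob_dominates.
- by apply/measurable_EFinP; exact: measurable_normal_pdf.
- move=> A _ mA; rewrite -Radon_Nikodym_SigmaFinite.f_integral//.
  exact: normal_prob_dominates.
Qed.

Lemma ge0_integral_normal_prob (f : R -> \bar R) :
  measurable_fun setT f -> (forall x, 0 <= f x)%E ->
  (\int[normal_prob m s]_x f x =
   \int[leb]_x (f x * (normal_pdf m s x)%:E))%E.
Proof.
move=> mf f0; have dom := @normal_prob_dominates R m s.
rewrite -(Radon_Nikodym_SigmaFinite.change_of_variables dom)//.
apply: ae_eq_integral => //.
- apply: emeasurable_funM => //.
  exact/measurable_int/Radon_Nikodym_SigmaFinite.f_integrable.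
- apply: emeasurable_funM => //.
  by apply/measurable_EFinP; exact: measurable_normal_pdf.
- exact/ae_eqe_mul2l/Radon_Nikodym_normal_prob.
Qed.

Lemma integrable_normal_prob (f : R -> R) : measurable_fun setT f ->
  leb.-integrable setT (EFin \o (fun x => f x * normal_pdf m s x)) ->
  (normal_prob m s).-integrable setT (EFin \o f).
Proof.
move=> mf /integrableP[_ intf]; apply/integrableP; split.
  exact/measurable_EFinP.
rewrite ge0_integral_normal_prob//; last first.
  by apply/measurable_EFinP; apply: measurableT_comp.
apply: le_lt_trans intf; rewrite le_eqVlt; apply/predU1P; left.
by apply: eq_integral => x _ /=;
  rewrite normrM [`|normal_pdf _ _ _|]ger0_norm ?normal_pdf_ge0.
Qed.

Lemma Rintegral_normal_prob (f : R -> R) :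
  (normal_prob m s).-integrable setT (EFin \o f) ->
  \int[normal_prob m s]_x f x = \int[leb]_x (f x * normal_pdf m s x).
Proof.
move=> intf; have dom := @normal_prob_dominates R m s.
rewrite /Rintegral -(Radon_Nikodym_change_of_variables dom)//.
congr fine; under [RHS]eq_integral do rewrite EFinM.
apply: ae_eq_integral => //.
- apply: emeasurable_funM; first exact: measurable_int intf.
  by apply: (measurable_int leb); exact: Radon_Nikodym_integrable.
- apply: emeasurable_funM; first exact: measurable_int intf.
  by apply/measurable_EFinP; exact: measurable_normal_pdf.
- apply: ae_eqe_mul2l.
  apply: ae_eq_trans Radon_Nikodym_normal_prob.
  exact/ae_eq_sym/ae_eq_Radon_Nikodym_SigmaFinite.
Qed.

End NormalIntegral.

Section IntegralDerivative.
Context (R : realType).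
Local Notation leb := (@lebesgue_measure R).

(** The fundamental theorem of calculus on growing symmetric intervals, then dominated convergence
    with bound [|f|]. *)
Lemma integral_derivative_eq0 (F f : R -> R) :
  (forall x : R, is_derive x 1 F (f x)) -> continuous f ->
  leb.-integrable setT (EFin \o f) ->
  F n%:R - F (- n%:R) @[n --> \oo] --> 0 ->
  \int[leb]_x f x = 0.
Proof.
move=> dF cf intf cF.
(* The successor keeps the interval nondegenerate at n = 0; [cvg_shiftS] undoes the shift at the
   end. *)
pose I n : set R := `[- n.+1%:R, n.+1%:R]%classic.
pose f_ n : R -> \bar R := (EFin \o f) \_ (I n).
have mf : measurable_fun setT (EFin \o f).
  by apply/measurable_EFinP; exact: continuous_measurable_fun.
have mf_ n : measurable_fun setT (f_ n).
  have mI : measurable (I n) by exact: measurable_itv.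
  by apply/(measurable_restrictT _ mI); exact: measurable_funTS.
have cvgf : {ae leb, forall x, setT x -> f_ ^~ x @ \oo --> (EFin \o f) x}.
  apply: aeW => x _; apply: (@cvg_near_cst _ _ ((EFin \o f) x)).
  near=> n; rewrite /f_ patchE ifT// inE /I /= in_itv/= -ler_norml.
  rewrite (@le_trans _ _ n%:R) ?ler_nat//.
  by near: n; exact: nbhs_infty_ger.
have domf : {ae leb, forall x n, setT x -> (`|f_ n x| <= (abse \o (EFin \o f)) x)%E}.
  apply: aeW => x n _; rewrite /f_ patchE; case: ifP => //= _.
  by rewrite normr0 lee_fin.
have [_ _ /= lim1] := @dominated_convergence _ _ _ leb _ measurableT f_ _ _
  mf_ mf cvgf (integrable_abse intf) domf.
have E n : (\int[leb]_x f_ n x = (F n.+1%:R - F (- n.+1%:R))%:E)%E.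
  rewrite /f_ -integral_mkcond EFinB; apply: continuous_FTC2.
  - by rewrite gtrN.
  - exact: continuous_subspaceT.
  - have cF' x : {for x, continuous F}.
      by apply: differentiable_continuous; apply/derivable1_diffP; have [] := dF x.
    split => [x _||]; first by have [] := dF x.
    + exact/cvg_at_right_filter/cF'.
    + exact/cvg_at_left_filter/cF'.
  - by move=> x _; rewrite derive1E; have [_ ->] := dF x.
have lim2 : (\int[leb]_x f_ n x)%E @[n --> \oo] --> 0%:E.
  under eq_fun do rewrite E; apply: cvg_EFin; first exact: nearW.
  by rewrite (@cvg_shiftS _ (fun n => F n%:R - F (- n%:R))).
by rewrite /Rintegral (cvg_unique _ lim1 lim2).
Unshelve. all: end_near. Qed.

End IntegralDerivative.

Section NormalCosine.
Context (R : realType).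
Local Notation leb := (@lebesgue_measure R).
Local Notation phi := (@normal_pdf R 0 1).
Implicit Types a b : R.

Lemma normal_pdf01E (x : R) : phi x = normal_peak 1 * expR (- (x ^+ 2 / 2)).
Proof.
rewrite normal_pdfE// /normal_fun subr0 expr1n.
by rewrite mulr2n mulNr.
Qed.

Lemma is_derive_normal_pdf01 (x : R) : is_derive x 1 phi (- (x * phi x)).
Proof.
have -> : phi = fun x => normal_peak 1 * expR (- (x ^+ 2 / 2)).
  by apply/funext => y; exact: normal_pdf01E.
apply: is_derive_eq.
by rewrite /GRing.scale /=; field.
Qed.

Lemma continuous_phi : continuous phi.
Proof. by apply: continuous_normal_pdf; rewrite oner_neq0. Qed.

(** [|x| <= 1 + x^2 / 4 <= expR (x^2 / 4)], so the factor [|x|] is absorbed by passing to the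
    Gaussian of variance 2; the ratio of peaks corrects the normalization. *)
Lemma norm_mul_normal_pdf01_le (x : R) :
  `|x| * phi x <= normal_peak 1 / normal_peak (Num.sqrt 2) *
    normal_pdf 0 (Num.sqrt 2) x.
Proof.
have s0 : Num.sqrt 2 != 0 :> R by rewrite sqrtr_eq0 -ltNge.
rewrite normal_pdf01E (normal_pdfE _ s0) /normal_fun subr0 sqr_sqrtr//.
rewrite mulrA divfK ?lt0r_neq0 ?normal_peak_gt0// mulrCA.
rewrite ler_pM2l ?normal_peak_gt0 ?oner_neq0//.
have -> : - x ^+ 2 / (2 *+ 2) = x ^+ 2 / 4 - x ^+ 2 / 2.
  by rewrite -mulr_natr; field.
rewrite expRD ler_wpM2r ?expR_ge0//; apply: le_trans (expR_ge1Dx _).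
rewrite -(real_normK (num_real x)).
have := sqr_ge0 (`|x| / 2 - 1); lra.
Qed.

Lemma integrable_norm_mul_phi :
  leb.-integrable setT (EFin \o (fun x => `|x| * phi x)).
Proof.
have i1 : leb.-integrable setT (EFin \o (fun x =>
    normal_peak 1 / normal_peak (Num.sqrt 2) * normal_pdf 0 (Num.sqrt 2) x)).
  exact: (@integrableZl _ _ _ _ _ measurableT _ _
    (@integrable_normal_pdf R 0 (Num.sqrt 2))).
apply: le_integrable i1 => //.
  apply/measurable_EFinP; apply: measurable_funM; first exact: normr_measurable.
  exact: measurable_normal_pdf.
move=> x _; rewrite lee_fin ger0_norm; last by rewrite mulr_ge0 ?normal_pdf_ge0.
by apply: le_trans (norm_mul_normal_pdf01_le x) _; exact: ler_norm.
Qed.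

Lemma continuous_sinMB a b : continuous (fun x : R => sin (a * x - b)).
Proof.
move=> x; apply: continuous_comp; last exact: continuous_sin.
by apply: cvgB; [exact: mulrl_continuous|exact: cvg_cst].
Qed.

Lemma integrable_cos_phi a b :
  leb.-integrable setT (EFin \o (fun x => cos (a * x - b) * phi x)).
Proof.
apply: (le_integrable _ _ _ (@integrable_normal_pdf R 0 1)) => //.
  apply/measurable_EFinP; apply: measurable_funM; last exact: measurable_normal_pdf.
  apply: continuous_measurable_fun; exact: continuous_cosMB.
move=> x _; rewrite lee_fin normrM ler_piMl ?cos_max//.
Qed.

Lemma integrable_mul_sin_phi a b :
  leb.-integrable setT (EFin \o (fun x => x * sin (a * x - b) * phi x)).
Proof.
apply: (le_integrable _ _ _ integrable_norm_mul_phi) => //.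
  apply/measurable_EFinP; apply: measurable_funM; last exact: measurable_normal_pdf.
  apply: measurable_funM => //.
  by apply: continuous_measurable_fun; exact: continuous_sinMB.
move=> x _; by rewrite lee_fin !normrM normr_id ler_wpM2r// ler_piMr// sin_max.
Qed.

(* Integration by parts: x phi x is minus the derivative of phi. *)
Lemma integral_mul_sin_phi a b :
  \int[leb]_x (x * sin (a * x - b) * phi x) =
  a * \int[leb]_x (cos (a * x - b) * phi x).
Proof.
have i1 := integrable_cos_phi a b; have i2 := integrable_mul_sin_phi a b.
apply/esym/eqP; rewrite -subr_eq0; apply/eqP.
rewrite -RintegralZl// -RintegralB//; last first.
  exact: (@integrableZl _ _ _ _ _ measurableT a _ i1).
apply: (@integral_derivative_eq0 _ (fun x => sin (a * x - b) * phi x)).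
- move=> x; have dphi := is_derive_normal_pdf01 x.
  apply: is_derive_eq.
  by rewrite /GRing.scale /=; ring.
- move=> x; apply: cvgB.
    apply: cvgM; first exact: cvg_cst.
    by apply: cvgM; [exact: continuous_cosMB|exact: continuous_phi].
  apply: cvgM; last exact: continuous_phi.
  by apply: cvgM; [exact: cvg_id|exact: continuous_sinMB].
- exact: (integrableB measurableT
    (@integrableZl _ _ _ _ _ measurableT a _ i1) i2).
- have peak0 : 0 < normal_peak (1 : R) by rewrite normal_peak_gt0.
  (* Decay of order 1 / (n + 1) of the boundary terms is enough; it follows from [expR (n^2 / 2) >=
     1 + n^2 / 2 >= (n + 1) / 2]. *)
  have bnd (y : R) n : `|y| = n%:R -> phi y <= 2 * normal_peak 1 * harmonic n.
    move=> yn; have y2 : y ^+ 2 = n%:R ^+ 2 by rewrite -yn real_normK ?num_real.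
    rewrite normal_pdf01E y2.
    have -> : 2 * normal_peak 1 * harmonic n = normal_peak 1 * (2 * harmonic n) :> R.
      by ring.
    rewrite ler_pM2l// /harmonic/=.
    rewrite expRN ler_pdivlMr ?ltr0n// mulrC ler_pdivrMr ?expR_gt0//.
    have := @expR_ge1Dx R (n%:R ^+ 2 / 2).
    rewrite -[n.+1%:R]natr1; have := sqr_ge0 (n%:R - 1 : R).
    by have := ler0n R n; lra.
  apply: norm_cvg0.
  apply: (@squeeze_cvgr _ _ _ _ (cst 0) (fun n => 4 * normal_peak 1 * harmonic n)).
  - apply: nearW => n; rewrite /= normr_ge0 /=.
    have h1 := bnd n%:R n (normr_nat _ _).
    have h2 := bnd (- n%:R) n; rewrite normrN normr_nat in h2; have {}h2 := h2 erefl.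
    rewrite /harmonic/= in h1 h2.
    apply: le_trans (ler_normB _ _) _; rewrite !normrM.
    have p1 := normal_pdf_ge0 0 1 (n%:R : R).
    have p2 := normal_pdf_ge0 0 1 (- n%:R : R).
    rewrite !(ger0_norm p1) !(ger0_norm p2).
    have := ler_wpM2r p1 (sin_max (a * n%:R - b)).
    have := ler_wpM2r p2 (sin_max (a * - n%:R - b)) => k1 k2.
    rewrite !mul1r in k1 k2; have -> : 4 * normal_peak 1 / n.+1%:R =
        2 * normal_peak 1 / n.+1%:R + 2 * normal_peak 1 / n.+1%:R :> R by ring.
    exact: lerD (le_trans k2 h1) (le_trans k1 h2).
  - exact: cvg_cst.
  - rewrite -[X in _ --> X](mulr0 (4 * normal_peak 1)).
    by apply: cvgM; [exact: cvg_cst|exact: cvg_harmonic].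
Qed.

Let J (b a : R) : R := \int[leb]_x (cos (a * x - b) * phi x).

(** Differentiation under the integral, dominated by [|x| phi x] uniformly in the parameter,
    followed by the integration by parts above. The resulting equation J' = - a J is solved next. *)
Lemma is_derive_normal_cos (b a : R) : is_derive a 1 (J b) (- (a * J b a)).
Proof.
pose f (a x : R) := cos (a * x - b) * phi x.
have df (t x : R) : is_derive t 1 (f ^~ x) (- (x * sin (t * x - b) * phi x)).
  rewrite /f; apply: is_derive_eq.
  by rewrite /GRing.scale /=; ring.
have d1f t x : partial1of2 f t x = - (x * sin (t * x - b) * phi x).
  by rewrite partial1of2E; have [_ ->] := df t x.
have Ia : (`]a - 1, a + 1[%classic : set R) a by rewrite /= in_itv/=; lra.
have intf (x : R) : (`]a - 1, a + 1[%classic : set R) x ->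
    leb.-integrable setT (EFin \o f x).
  by move=> _; exact: integrable_cos_phi.
have derf (t x : R) : (`]a - 1, a + 1[%classic : set R) t -> setT x ->
    derivable (f ^~ x) t 1.
  by move=> _ _; have [] := df t x.
have G0 (x : R) : 0 <= `|x| * phi x by rewrite mulr_ge0 ?normal_pdf_ge0.
have Gub (t x : R) : (`]a - 1, a + 1[%classic : set R) t -> setT x ->
    `|partial1of2 f t x| <= `|x| * phi x.
  move=> _ _; rewrite d1f normrN !normrM [`|phi x|]ger0_norm ?normal_pdf_ge0//.
  by rewrite ler_wpM2r ?normal_pdf_ge0// ler_piMr// sin_max.
have D1 := derivable_under_integral measurableT Ia intf derf G0
  integrable_norm_mul_phi Gub.
have D2 := differentiation_under_integral measurableT Ia intf derf G0
  integrable_norm_mul_phi Gub.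
apply: DeriveDef; first exact: D1.
rewrite -derive1E [LHS]D2 /J -integral_mul_sin_phi -mulN1r -RintegralZl//.
  by apply: eq_Rintegral => x _; rewrite d1f mulN1r.
exact: integrable_mul_sin_phi.
Qed.

Lemma lebesgue_integral_normal_cos a b :
  \int[leb]_x (cos (a * x - b) * phi x) = cos b * expR (- (a ^+ 2 / 2)).
Proof.
have dK (t : R) : is_derive t 1 (fun t => J b t * expR (t ^+ 2 / 2)) 0.
  have dJ := is_derive_normal_cos b t.
  apply: is_derive_eq.
  by rewrite /GRing.scale /=; field.
have := is_derive_0_is_cst a 0 dK.
rewrite expr0n mul0r expR0 mulr1.
have -> : J b 0 = cos b.
  rewrite /J; under eq_Rintegral do rewrite mul0r sub0r cosN.
  rewrite RintegralZl//; last exact: integrable_normal_pdf.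
  by rewrite /Rintegral integral_normal_pdf mulr1.
by move=> <-; rewrite -mulrA -expRD subrr expR0 mulr1.
Qed.

Lemma integrable_normal_prob_norm :
  (normal_prob 0 1).-integrable setT (EFin \o (@Num.norm R R)).
Proof.
apply: integrable_normal_prob; first exact: normr_measurable.
exact: integrable_norm_mul_phi.
Qed.

Lemma integral_normal_prob_cos a b :
  \int[normal_prob 0 1]_x cos (a * x - b) = cos b * expR (- (a ^+ 2 / 2)).
Proof.
rewrite Rintegral_normal_prob ?lebesgue_integral_normal_cos//.
apply: integrable_normal_prob; last exact: integrable_cos_phi.
by apply: continuous_measurable_fun; exact: continuous_cosMB.
Qed.

End NormalCosine.

(** * Laws given by a polynomial *)

Section BorelValued.
Context (R : realType) (d : measure_display) (T : measurableType d).

(* [normal_prob] lives on [measurableTypeR R], whose display differs from that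
   of the default measurable structure on [R]. *)
Definition borel_valued (f : T -> R) : T -> measurableTypeR R := f.

Lemma measurable_borel_valued (f : {mfun T >-> R}) :
  measurable_fun [set: T] (borel_valued f).
Proof. by move=> mT B mB; exact: (@measurable_funPT _ _ _ _ f). Qed.

HB.instance Definition _ (f : {mfun T >-> R}) :=
  isMeasurableFun.Build _ _ T (measurableTypeR R) (borel_valued f)
    (measurable_borel_valued f).

End BorelValued.

Section PolynomialLaw.
Context (R : realType) (d : measure_display) (T : measurableType d).
Context (P : probability T R) (X : {RV P >-> R}) (L : {poly R}).
Hypothesis L1 : L.[1] != 0.
Hypothesis lawX : forall k, pmf X k%:R = L`_k / L.[1].

Let A (k : nat) : set T := X @^-1` [set k%:R].

Let mA k : measurable (A k).
Proof. exact: measurable_funPTI. Qed.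

Let PA k : P (A k) = (L`_k / L.[1])%:E.
Proof. by rewrite -lawX /pmf fineK// fin_num_measure. Qed.

Let S := \big[setU/set0]_(k < size L) A k.

Let mS : measurable S.
Proof. by apply: bigsetU_measurable => k _; exact: mA. Qed.

(** The atoms at 0, ..., [size L] - 1 already have total mass L(1) / L(1) = 1, so the real variable
    [X] almost surely takes one of these finitely many values. *)
Let PS : P (~` S) = 0%E.
Proof.
rewrite probability_setC//.
have -> : P S = 1%E.
  rewrite /S measure_bigsetU_ord//; last first.
    move=> i j _ _ [w []]; rewrite /A /= => -> /eqP; rewrite eqr_nat => /eqP ij.
    exact: val_inj.
  rewrite (eq_bigr (fun i : 'I_(size L) => (L`_i / L.[1])%:E)); last first.
    by move=> i _; exact: PA.
  rewrite sumEFin -mulr_suml.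
  have -> : \sum_(i < size L) L`_i = L.[1].
    by rewrite wcoef_sum_one; apply: eq_bigr => i _; rewrite mulr1.
  by rewrite divff.
by rewrite subee.
Qed.

Lemma polynomial_law_integral (f : R -> R) : measurable_fun setT f ->
  P.-integrable setT (EFin \o (f \o X)) /\
  \int[P]_w f (X w) = wcoef_sum (fun k => f k%:R) L / L.[1].
Proof.
move=> mf.
pose h (k : 'I_(size L)) (w : T) : \bar R := (f k%:R * \1_(A k) w)%:E.
have ih (i : 'I_(size L)) : P.-integrable setT (h i).
  rewrite /h; under eq_fun do rewrite EFinM.
  by apply: integrableZl => //; exact: integrable_indic.
pose g (w : T) : \bar R := (\sum_(k < size L) h k w)%E.
have ig : P.-integrable setT g by exact: integrable_sum.
have mfX : measurable_fun setT (EFin \o (f \o X)).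
  by apply/measurable_EFinP; apply: measurableT_comp.
have fg : ae_eq P setT (EFin \o (f \o X)) g.
  exists (~` S); split => //; first exact: measurableC.
  move=> w /= /not_implyP[_ fgw] Sw; apply: fgw.
  move: Sw; rewrite /S -bigcup_seq /= => -[k _ kw].
  rewrite /g (bigD1 k)//= big1 ?adde0.
    by rewrite /h indicE mem_set// mulr1 kw.
  move=> j jk; rewrite /h indicE memNset ?mulr0// => jw.
  move: jk; rewrite -(inj_eq val_inj) -(eqr_nat R) => /negP; apply.
  by rewrite -jw kw.
split.
  apply/integrableP; split => //.
  have /integrableP[_] := ig; congr (_ < _)%E.
  apply: ae_eq_integral => //.
  - by apply: measurableT_comp => //; exact: measurable_int ig.
  - by apply: measurableT_comp.
  - apply: filterS fg => w /= fgw _; rewrite -fgw//.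
have mg := measurable_int _ ig.
have -> : \int[P]_w f (X w) = fine (\int[P]_w g w)%E.
  by rewrite /Rintegral; congr fine; exact: ae_eq_integral.
rewrite /g integral_sum//.
have hE (k : 'I_(size L)) : (\int[P]_w h k w = (f k%:R * (L`_k / L.[1]))%:E)%E.
  rewrite /h; under eq_integral do rewrite EFinM.
  rewrite integralZl//; last exact: integrable_indic.
  by rewrite integral_indic// setIT EFinM -PA.
under eq_bigr do rewrite hE.
rewrite sumEFin /= /wcoef_sum mulr_suml; apply: eq_bigr => k _.
by rewrite mulrA [f _ * _]mulrC.
Qed.

Lemma polynomial_law_expectation : fine 'E_P[X] = poly_mean L.
Proof.
have [_] := @polynomial_law_integral id (@measurable_id _ _ _).
by rewrite unlock /poly_mean wcoef_sum_id.
Qed.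

Lemma wcoef_sum_sqrB (c : R) : wcoef_sum (fun k => (k%:R - c) ^+ 2) L =
  wcoef_sum (fun k => k%:R ^+ 2) L - 2 * c * wcoef_sum (fun k => k%:R) L +
  c ^+ 2 * L.[1].
Proof.
rewrite wcoef_sum_one /wcoef_sum !mulr_sumr -sumrB -big_split /=.
by apply: eq_bigr => k _; ring.
Qed.

Lemma polynomial_law_variance : fine 'V_P[X] = poly_var L.
Proof.
rewrite /variance unlock polynomial_law_expectation unlock /=.
have mf : measurable_fun setT (fun x : R => (x - poly_mean L) ^+ 2).
  by apply: measurable_funX; exact: measurable_funB.
have [_] := polynomial_law_integral mf.
rewrite /Rintegral => E; transitivity
  (wcoef_sum (fun k => (k%:R - poly_mean L) ^+ 2) L / L.[1]).
  by rewrite -E; congr fine; apply: eq_integral => w _.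
rewrite wcoef_sum_sqrB -wcoef_sum_sqr -wcoef_sum_id /poly_var /poly_mean.
by field.
Qed.

Lemma standardized_law_integral (f : R -> R) : measurable_fun setT f ->
  (distribution P (borel_valued (standardize X))).-integrable setT (EFin \o f) /\
  \int[distribution P (borel_valued (standardize X))]_y f y =
    wcoef_sum (fun k => f ((k%:R - poly_mean L) / Num.sqrt (poly_var L))) L / L.[1].
Proof.
move=> mf; pose g (x : R) := f ((x - poly_mean L) / Num.sqrt (poly_var L)).
have mg : measurable_fun setT g.
  by apply: measurableT_comp => //; apply: measurable_funM => //; exact: measurable_funB.
have [ig Eg] := polynomial_law_integral mg.
have gE : (EFin \o (g \o X)) = (EFin \o f) \o (borel_valued (standardize X)).
  apply/funext => w /=; rewrite /g /borel_valued /standardize.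
  by rewrite polynomial_law_expectation polynomial_law_variance.
have mEf : measurable_fun [set: measurableTypeR R] (EFin \o f).
  by apply/measurable_EFinP; exact: mf.
rewrite gE in ig; split.
  exact: integrable_pushforward.
rewrite -Eg /Rintegral; congr fine.
rewrite (integral_distribution mEf ig) -gE.
by apply: eq_integral.
Qed.

End PolynomialLaw.

(** * Asymptotic normality *)

(** The upper limit is an infimum, over neighbourhoods of infinity, of suprema; a strict bound is
    therefore attained by one of these suprema, which serves as [r]. *)
Lemma limn_esup_lt_near (R : realType) (u : nat -> R) (c : R) :
  (limn_esup (fun n => (u n)%:E) < c%:E)%E ->
  exists2 r : R, r < c & \forall n \near \oo, u n <= r.
Proof.
move=> /ereal_inf_lt[_ [V Voo <-]] supV.
have uV n : V n -> ((u n)%:E <= ereal_sup ((fun n => (u n)%:E) @` V))%E.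
  by move=> Vn; apply: ereal_sup_ubound; exists n.
move: supV uV; case: (ereal_sup _) => [r| |].
- rewrite lte_fin => rc uV; exists r => //.
  by apply: filterS Voo => n /uV; rewrite lee_fin.
- by rewrite ltNge leey.
- move=> _ uV; exists (c - 1); first by rewrite ltrBlDr ltrDl.
  by apply: filterS Voo => n /uV; rewrite leeNy_eq.
Qed.

Lemma cvg_invr_card (R : realType) (k : nat -> nat) :
  k n @[n --> \oo] --> \oo -> (k n)%:R^-1 @[n --> \oo] --> (0 : R).
Proof.
move=> koo; have inv0 : (n%:R^-1 : R) @[n --> \oo] --> 0.
  rewrite gtr0_cvgV0; first exact: cvgr_idn.
  by near=> n; rewrite ltr0n; near: n; exact: nbhs_infty_gt.
exact: (cvg_comp _ _ koo inv0).
Unshelve. all: end_near. Qed.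

(** Everything follows from [t^2 <= a^2 / (c N^3)]; the threshold on [N] is exactly what turns this
    into [(N t)^2 <= 4]. *)
Lemma clt_scale_bounds (R : realType) (N v c a : R) :
  0 < N -> 0 < c -> c * N ^+ 3 <= v -> 0 < a -> a ^+ 2 / (4 * c) <= N ->
  let t := a / Num.sqrt v in
  [/\ 0 < t, N * t <= 2, v * t ^+ 2 = a ^+ 2 &
      t ^+ 4 * N ^+ 5 / 144 <= a ^+ 4 / (144 * c ^+ 2) * N^-1].
Proof.
move=> N0 c0 cv a0 aN t.
have N30 : 0 < N ^+ 3 by rewrite exprn_gt0.
have v0 : 0 < v by apply: lt_le_trans cv; rewrite mulr_gt0.
have t0 : 0 < t by rewrite divr_gt0// sqrtr_gt0.
have t2 : t ^+ 2 = a ^+ 2 / v by rewrite expr_div_n sqr_sqrtr// ltW.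
have t2le : t ^+ 2 <= a ^+ 2 / (c * N ^+ 3).
  rewrite t2 ler_pM2l ?exprn_gt0// lef_pV2 ?posrE// mulr_gt0//.
split=> //.
- have h : (N * t) ^+ 2 <= 2 ^+ 2.
    rewrite exprMn; apply: le_trans (ler_wpM2l (exprn_ge0 2 (ltW N0)) t2le) _.
    have -> : N ^+ 2 * (a ^+ 2 / (c * N ^+ 3)) = 4 * (a ^+ 2 / (4 * c)) / N.
      by field; rewrite !lt0r_neq0.
    by rewrite ler_pdivrMr//; lra.
  by move: h; rewrite ler_sqr ?nnegrE// ltW// mulr_gt0.
- by rewrite t2 mulrC divfK// lt0r_neq0.
- have t40 : t ^+ 4 <= (a ^+ 2 / (c * N ^+ 3)) ^+ 2.
    rewrite (exprM t 2 2) ler_sqr ?nnegrE ?sqr_ge0//.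
    by rewrite divr_ge0 ?sqr_ge0// ltW// mulr_gt0.
  have N5 : 0 < N ^+ 5 / 144 by rewrite divr_gt0// exprn_gt0.
  rewrite -mulrA; apply: le_trans (ler_wpM2r (ltW N5) t40) _.
  by rewrite le_eqVlt; apply/orP; left; apply/eqP; field; rewrite !lt0r_neq0.
Qed.

Section Forests.
Context (R : realType) (d : Order.disp_t) (P : nat -> finPOrderType d).
Hypothesis forestP : forall n, is_forest (P n).
Hypothesis cardP : #|P n| @[n --> \oo] --> \oo.
Hypothesis rankP : (limn_esup
  (fun n => ((poset_rank (P n))%:R / #|P n|%:R : R)%:E) < 1)%E.
Local Notation L n := (forest_poly R (P n)).

Lemma card_gt_near (x : R) : \forall n \near \oo, x < #|P n|%:R.
Proof.
have := nbhs_infty_gtr x => /cardP; exact.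
Qed.

Lemma forest_var_cubic : exists2 c : R, 0 < c &
  \forall n \near \oo, c * #|P n|%:R ^+ 3 <= poly_var (L n).
Proof.
have [r r1 rn] := limn_esup_lt_near rankP.
have e0 : 0 < 1 - r by rewrite subr_gt0.
(* A rank at most [r n] leaves a gap of at least [(1 - r) n], whose fourth power
   [forest_poly_var_ge] divides by [48 n]. *)
exists ((1 - r) ^+ 4 / 48); first by rewrite divr_gt0// exprn_gt0.
near=> n.
have N0 : (0 : R) < #|P n|%:R by near: n; exact: card_gt_near.
have rk : (poset_rank (P n))%:R / #|P n|%:R <= r by near: n.
rewrite ler_pdivrMr// in rk.
have := forest_poly_var_ge R (forestP (n := n)).
rewrite natrB ?rank_le_card// => vge.
have gap : (1 - r) * #|P n|%:R <= #|P n|%:R - (poset_rank (P n))%:R by lra.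
have gap4 : ((1 - r) * #|P n|%:R) ^+ 4 <= 48 * #|P n|%:R * poly_var (L n).
  apply: le_trans vge; rewrite lerXn2r ?nnegrE//.
    by rewrite mulr_ge0// ltW.
  by apply: le_trans gap; rewrite mulr_ge0// ltW.
have -> : (1 - r) ^+ 4 / 48 * #|P n|%:R ^+ 3 =
    ((1 - r) * #|P n|%:R) ^+ 4 / (48 * #|P n|%:R).
  by field; rewrite lt0r_neq0.
by rewrite ler_pdivrMr ?mulr_gt0// [leRHS]mulrC.
Unshelve. all: end_near. Qed.

Lemma cvg_forest_cf (a : R) : 0 < a ->
  (\forall n \near \oo, 0 < a / Num.sqrt (poly_var (L n)) /\
     #|P n|%:R * (a / Num.sqrt (poly_var (L n))) <= 2) /\
  forest_cf (P n) (a / Num.sqrt (poly_var (L n))) @[n --> \oo] -->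
    expR (- (a ^+ 2 / 2)).
Proof.
move=> a0; have [c c0 cn] := forest_var_cubic.
pose K := a ^+ 4 / (144 * c ^+ 2).
have scale : \forall n \near \oo,
    [/\ 0 < a / Num.sqrt (poly_var (L n)),
      #|P n|%:R * (a / Num.sqrt (poly_var (L n))) <= 2,
      poly_var (L n) * (a / Num.sqrt (poly_var (L n))) ^+ 2 = a ^+ 2 &
      (a / Num.sqrt (poly_var (L n))) ^+ 4 * #|P n|%:R ^+ 5 / 144 <=
        K * #|P n|%:R^-1].
  near=> n; apply: clt_scale_bounds => //.
  - by near: n; exact: card_gt_near.
  - by near: n.
  - by apply: ltW; near: n; exact: card_gt_near.
split; first by apply: filterS scale => n [].
have cvgE (s : R) : expR (- (a ^+ 2 / 2) + s * (K * #|P n|%:R^-1)) @[n --> \oo] -->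
    expR (- (a ^+ 2 / 2)).
  have lin : - (a ^+ 2 / 2) + s * (K * #|P n|%:R^-1) @[n --> \oo] -->
      - (a ^+ 2 / 2) + s * (K * 0).
    apply: cvgD; first exact: cvg_cst.
    apply: cvgM; first exact: cvg_cst.
    by apply: cvgM; [exact: cvg_cst|exact: cvg_invr_card].
  rewrite !mulr0 addr0 in lin.
  exact: (cvg_comp _ _ lin (@continuous_expR R _)).
apply: squeeze_cvgr (cvgE (-1)) (cvgE 1).
near=> n.
have [t0 nt vt tK] : [/\ 0 < a / Num.sqrt (poly_var (L n)),
      #|P n|%:R * (a / Num.sqrt (poly_var (L n))) <= 2,
      poly_var (L n) * (a / Num.sqrt (poly_var (L n))) ^+ 2 = a ^+ 2 &
      (a / Num.sqrt (poly_var (L n))) ^+ 4 * #|P n|%:R ^+ 5 / 144 <=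
        K * #|P n|%:R^-1] by near: n.
have /andP[lo hi] := forest_cf_bounds (forestP (n := n)) t0 nt.
rewrite vt in lo hi; apply/andP; split.
  by apply: le_trans lo; rewrite ler_expR; lra.
by apply: le_trans hi _; rewrite ler_expR; lra.
Unshelve. all: end_near. Qed.

End Forests.

Theorem theorem1p13 (R : realType) (d : Order.disp_t)
    (P : nat -> finPOrderType d)
    (forestP : forall n, is_forest (P n))
    (cardP : #|P n| @[n --> \oo] --> \oo)
    (rankP : (limn_esup
      (fun n => ((poset_rank (P n))%:R / #|P n|%:R : R)%:E) < 1)%E)
    (dT : measure_display) (T : nat -> measurableType dT)
    (Pr : forall n, probability (T n) R)
    (X : forall n, {RV (Pr n) >-> R})
    (lawX : forall n k,
      pmf (X n) k%:R =
        (forest_poly R (P n))`_k / (forest_poly R (P n)).[1]) :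
  asymptotically_normal Pr (fun n => standardize (X n)).
Proof.
pose L n := forest_poly R (P n).
have L1 n : (L n).[1] != 0 by exact: forest_poly1_neq0.
have [c c0 varP] := forest_var_cubic forestP cardP rankP.
have var0 : \forall n \near \oo, 0 < poly_var (L n).
  near=> n; apply: (@lt_le_trans _ _ (c * #|P n|%:R ^+ 3)); last by near: n.
  by rewrite mulr_gt0// exprn_gt0//; near: n; exact: card_gt_near.
pose nu n : probability (measurableTypeR R) R :=
  distribution (Pr n) (borel_valued (standardize (X n))).
have law n (f : R -> R) (mf : measurable_fun setT f) :=
  standardized_law_integral (L1 n) (lawX n) mf.
have cvgcos_pos a b : 0 < a -> \int[nu n]_y cos (a * y - b) @[n --> \oo] -->
    cos b * expR (- (a ^+ 2 / 2)).
  move=> a0; have [nt cvgcf] := cvg_forest_cf forestP cardP rankP a0.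
  apply: cvg_trans (cvgM (cvg_cst (cos b)) cvgcf).
  apply: near_eq_cvg; near=> n.
  have [t0 n2] : 0 < a / Num.sqrt (poly_var (L n)) /\
     #|P n|%:R * (a / Num.sqrt (poly_var (L n))) <= 2 by near: n.
  have [_ ->] := law n (fun y => cos (a * y - b))
    (continuous_measurable_fun (@continuous_cosMB R a b)).
  set t := a / Num.sqrt (poly_var (L n)) in t0 n2 *.
  (* At [y = (k - mean) / sigma] the angle [a y - b] equals [k t - (b + mean t)], which dictates
     this phase. *)
  have := forest_cos_sum (forestP n) (b + poly_mean (L n) * t) t0 n2.
  have -> : poly_mean (L n) * t - (b + poly_mean (L n) * t) = - b by ring.
  rewrite cosN => E; transitivity (cos b * forest_cf (P n) t) => //.
  rewrite -E; congr (_ / _); apply: eq_bigr => k _.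
  by congr (_ * cos _); rewrite /t; ring.
have cvgcos a b : \int[nu n]_y cos (a * y - b) @[n --> \oo] -->
    \int[normal_prob 0 1]_y cos (a * y - b).
  rewrite integral_normal_prob_cos.
  (* The product formula is for positive [t]. Negative frequencies follow from the parity of the
     cosine, and frequency 0 is a constant integrand. *)
  have [a0|a0|->] := ltgtP a 0.
  - have := cvgcos_pos (- a) (- b); rewrite oppr_gt0 cosN sqrrN => /(_ a0).
    by under eq_fun do under eq_Rintegral do rewrite mulNr -opprD cosN.
  - exact: cvgcos_pos.
  - have int0 n : \int[nu n]_y cos (0 * y - b) = cos b.
      under eq_Rintegral do rewrite mul0r sub0r cosN.
      by rewrite Rintegral_cst// (congr1 fine (probability_setT (nu n))) mulr1.
    under eq_fun do rewrite int0.
    by rewrite expr0n mul0r oppr0 expR0 mulr1; exact: cvg_cst.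
(* The bound 2 comes from [|y| <= 1 + y^2] and the second moment of the standardized variable, which
   is 1 once the variance is positive. *)
have bounded : \forall n \near \oo,
    (nu n).-integrable setT (EFin \o (@Num.norm R R)) /\ \int[nu n]_y `|y| <= 2.
  near=> n; have [ia _] := law n _ (@normr_measurable R setT); split=> //.
  have mq : measurable_fun setT (fun y : R => 1 + y ^+ 2).
    by apply: measurable_funD => //; exact: measurable_funX.
  have [iq Eq] := law n _ mq.
  have v0 : 0 < poly_var (L n) by near: n.
  apply: (@le_trans _ _ (\int[nu n]_y (1 + y ^+ 2))).
    apply: le_Rintegral => // y _.
    by rewrite -(real_normK (num_real y)); have := sqr_ge0 (`|y| - 1); nra.
  rewrite Eq le_eqVlt; apply/orP; left; apply/eqP.
  have -> : wcoef_sum (fun k => 1 + ((k%:R - poly_mean (L n)) /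
       Num.sqrt (poly_var (L n))) ^+ 2) (L n) =
     (L n).[1] +
     wcoef_sum (fun k => (k%:R - poly_mean (L n)) ^+ 2) (L n) / poly_var (L n).
    rewrite wcoef_sum_one /wcoef_sum mulr_suml -big_split; apply: eq_bigr => k _.
    by rewrite mulrDr expr_div_n sqr_sqrtr ?ltW// mulrA.
  have : poly_var (L n) * (L n).[1] =
     wcoef_sum (fun k => (k%:R - poly_mean (L n)) ^+ 2) (L n).
    rewrite wcoef_sum_sqrB -wcoef_sum_sqr -wcoef_sum_id /poly_var /poly_mean.
    by field.
  by move=> <-; field; rewrite L1 lt0r_neq0.
move=> x cx.
exact: (@cos_transform_continuity R (normal_prob 0 1) nu 2 cvgcos
  (@integrable_normal_prob_norm R) bounded x cx).
Unshelve. all: end_near. Qed.
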